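(* Let $L=L(k_1,\ldots,k_r)$ be an alternating link diagram with $r$ labeled maximal negative twist regions having $k_1,\ldots,k_r\ge 1$ crossings respectively. Then $$\langle L(k_1,\ldots,k_r)\rangle \doteq_{4k} \langle L(k_1-1,\ldots,k_r-1)\rangle,$$ where $k=\min_{1\le i\le r}k_i$.
   Context: Kauffman bracket: for a link diagram $D$ in $S^2$, $\langle D\rangle\in\mathbb{Z}[A^{\pm1}]$ is determined by $\langle\text{empty diagram}\rangle=1$, $\langle D\sqcup\bigcirc\rangle=-(A^2+A^{-2})\langle D\rangle$, and $\langle\text{crossing}\rangle=A\langle\text{positive smoothing}\rangle+A^{-1}\langle\text{negative smoothing}\rangle$ at each crossing (positive smoothing = the standard $A$-smoothing, negative smoothing = the standard $A^{-1}$-smoothing). Twist regions: a negative twist region with $k$ crossings is a part of the diagram consisting of the two-strand tangle $\sigma^k$ (two strands twisted around each other, $k$ crossings stacked in a row), where each crossing $\sigma$ has the handedness for which its negative smoothing is the trivial tangle $1$ of two parallel strands and its positive smoothing is the cup-cap tangle $e$; so $\sigma=A\,e+A^{-1}\,1$ in the Temperley-Lieb algebra $TL_2$. It is maximal if it is not contained in a negative twist region with more crossings. $L(k_1,\ldots,k_r)$ denotes a diagram with $r$ labeled maximal negative twist regions (possibly only a subset of all those in the diagram), the $i$-th having $k_i\ge1$ crossings. For integers $b_i$ with $k_i+b_i\ge 0$, $L(k_1+b_1,\ldots,k_r+b_r)$ is the diagram obtained by replacing, for each $i$, the $i$-th tangle $\sigma^{k_i}$ by $\sigma^{k_i+b_i}$,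 with $\sigma^0=1$ (two parallel strands, the negative smoothing). Notation $\doteq_n$: for nonzero $P_1,P_2\in\mathbb{Z}[x^{-1}][[x]]$ write $P_1\doteq_n P_2$ if the lists of the first $n$ coefficients (coefficients of consecutive powers of $x$, zeros included, starting from the lowest-degree nonzero term of each series) agree up to one overall sign. Here the variable is $x=A$. *)

(* Defs.v *)
From mathcomp Require Import all_boot all_order all_algebra.
From mathcomp Require Import fraction.

Set Implicit Arguments.
Unset Strict Implicit.
Unset Printing Implicit Defensive.

Import Order.TTheory GRing.Theory Num.Theory.
Local Open Scope ring_scope.

(** * Laurent polynomials in A *)

(* Z[A, A^-1] is used inside its field of fractions. *)
Definition laurent := {fraction {poly int}}.
Definition A : laurent := FracField.tofrac 'X.

(* [doteq n P1 P2]: [P1] and [P2] are nonzero Laurent polynomials, with lowest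
   degrees [a1] and [a2], and their first [n] coefficients counted from the
   lowest-degree nonzero term agree up to one overall sign. *)
Definition doteq (n : nat) (P1 P2 : laurent) : Prop :=
  exists (a1 a2 : int) (p1 p2 : {poly int}) (s : bool),
    [/\ P1 = A ^ a1 * FracField.tofrac p1, p1`_0 != 0,
        P2 = A ^ a2 * FracField.tofrac p2, p2`_0 != 0
      & forall i : nat, (i < n)%N -> p1`_i = (-1) ^+ s * p2`_i].

(** * Link diagrams *)

(* The four ends at a vertex [v] are the darts [(v, p)] with [p : 'I_4], the
   integers mod 4, in counterclockwise order. *)
Definition turn (V : finType) (x : V * 'I_4) (i : 'I_4) : V * 'I_4 :=
  (x.1, x.2 + i).

(* A 4-valent map on a closed oriented surface. *)
Record shadow (V : finType) := Shadow {
  edge : V * 'I_4 -> V * 'I_4;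
  edgeK : involutive edge;
  edge_neq : forall x, edge x != x }.

(* Every vertex of the 4-valent map is either a crossing ([kind v = None]),
   whose strand 0-2 passes under its strand 1-3, or is already smoothed,
   positively ([Some true]) or negatively ([Some false]).  Allowing smoothed
   vertices gives crossingless components and lets the map of a split diagram
   be connected (let its components touch at smoothed vertices), so that the
   relative position of the components in the sphere is recorded. *)
Record diagram := Diagram {
  vertex : finType;
  shape :> shadow vertex;
  kind : vertex -> option bool }.

Notation dart D := (vertex D * 'I_4)%type.

(* Sweeping the over strand 1-3 counterclockwise covers the corners between
   ends 1, 2 and between ends 3, 0.  The positive smoothing joins these two
   corners: its arcs are 0-1 and 2-3.  The arcs of the negative smoothing are
   1-2 and 3-0. *)
Definition smoothing_arc (b : bool) (p : 'I_4) : 'I_4 :=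
  if b then 1 - p else - 1 - p.

Section Sphere.
Variables (V : finType) (G : shadow V).

(* Leave along an end and then turn left at the next vertex. *)
Definition face (x : V * 'I_4) : V * 'I_4 := turn (edge G x) (- 1).

Definition components : nat :=
  n_comp [rel x y : V * 'I_4 | (y == edge G x) || (y.1 == x.1)] predT.

(* The map is empty, or it is connected and has Euler characteristic 2. *)
Definition spherical : Prop :=
  (components <= 1)%N /\
  (#|V| + fcard face predT = fcard (edge G) predT + components.*2)%N.

(* The number of circles of the state [s], where [s v] tells which smoothing
   is taken at [v] *)
Definition circles (s : V -> bool) : nat :=
  n_comp [rel x y : V * 'I_4 |
    (y == edge G x) || (y == (x.1, smoothing_arc (s x.1) x.2))] predT.

End Sphere.

(** * The Kauffman bracket *)

Definition bracket (D : diagram) : laurent :=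
  \sum_(s : {ffun vertex D -> bool} |
        [forall v, (kind v == None) || (kind v == Some (s v))])
    (\prod_(v | kind v == None) (if s v then A else A^-1)) *
    (- (A ^+ 2 + A ^- 2)) ^+ circles D s.

Definition smooth (D : diagram) (v : vertex D) (b : bool) : diagram :=
  Diagram D (fun w => if w == v then Some b else kind w).

(* The state sum [bracket] satisfies the rules of the Kauffman bracket; the
   rules for the empty diagram and for adding a circle amount to the value on
   crossingless diagrams. *)
Lemma bracket_crossingless (D : diagram) (s : vertex D -> bool) :
  (forall v, kind v = Some (s v)) ->
  bracket D = (- (A ^+ 2 + A ^- 2)) ^+ circles D s.
Proof.
move=> Ds; rewrite /bracket (big_pred1 (finfun s)) => [|t].
  rewrite big_pred0 => [|v]; last by rewrite Ds.
  rewrite mul1r; suff -> : circles D (finfun s) = circles D s by [].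
  apply: eq_n_comp; apply: eq_connect => x y.
  by rewrite /= ffunE.
rewrite /=; apply/forallP/eqP => [tP|-> v]; last by rewrite ffunE Ds eqxx orbT.
by apply/ffunP=> v; move/(_ v): tP; rewrite ffunE Ds /= => /eqP[].
Qed.

Lemma bracket_skein (D : diagram) (v : vertex D) : kind v = None ->
  bracket D = A * bracket (smooth v true) + A^-1 * bracket (smooth v false).
Proof.
move=> Dv; rewrite /bracket (bigID (fun s : {ffun _ -> bool} => s v)) /=.
have prodE (s : {ffun vertex D -> bool}) b :
    \prod_(w | kind w == None) (if s w then A else A^-1) =
    (if s v then A else A^-1) *
    \prod_(w | kind (d := smooth v b) w == None) (if s w then A else A^-1).
  rewrite (bigD1 v) ?Dv //=; apply: f_equal; apply: eq_bigl => w.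
  by rewrite andbC; case: eqP.
have compat (s : {ffun vertex D -> bool}) b :
    [forall w, (kind w == None) || (kind w == Some (s w))] && (s v == b) =
    [forall w, (kind (d := smooth v b) w == None) ||
               (kind (d := smooth v b) w == Some (s w))].
  apply/andP/forallP => [[/forallP sP /eqP sv] w|sP] /=.
    by case: (w =P v) => [->|_]; rewrite ?sv ?eqxx //; apply: sP.
  split; last by have := sP v; rewrite /= eqxx /= => /eqP[->].
  by apply/forallP => w; have := sP w; rewrite /=; case: (w =P v) => // ->; rewrite Dv.
rewrite !mulr_sumr; apply: f_equal2.
  apply: eq_big => [s|s /andP[_ sv]]; first by rewrite -compat; case: (s v).
  by rewrite (prodE _ true) sv mulrA.
apply: eq_big => [s|s /andP[_ /negbTE sv]]; first by rewrite -compat; case: (s v).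
by rewrite (prodE _ false) sv mulrA.
Qed.

(** * Alternating diagrams and twist regions *)

Section Diagram.
Variable D : diagram.
Implicit Types x y : dart D.

Definition crossing_end x : bool := kind x.1 == None.
Definition over x : bool := odd x.2.

Definition follow : rel (dart D) :=
  [rel x y | (y == edge D x) ||
             (if kind x.1 is Some b then y == (x.1, smoothing_arc b x.2)
              else false)].

(* [x] and [y] are the two ends of a piece of strand of the diagram which does
   not pass through a crossing. *)
Definition joined x y : bool :=
  [&& crossing_end x, crossing_end y, x != y & connect follow x y].

Definition alternating : Prop := forall x y, joined x y -> over x != over y.

(* The corner of a dart [(v, p)] is the one between the ends [p] and [p + 1] of
   [v]; it lies to the left of an observer leaving [v] along the end [p].
   [boundary] walks along the boundary of a region of the complement of the
   diagram, with the region on the left: it turns left at crossings and follows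
   the arcs of the smoothed vertices. *)
Definition boundary x : dart D :=
  let y := edge D x in
  if kind y.1 is Some b then (y.1, smoothing_arc b y.2) else turn y (- 1).

(* The corners of [x] and [y] lie in the same region.  At a smoothed vertex two
   opposite corners are merged, the ones not cut off by an arc. *)
Definition same_region : rel (dart D) :=
  connect [rel x y | (y == boundary x) ||
    (if kind x.1 is Some b
     then (smoothing_arc b x.2 != x.2 + 1) && (y == turn x 2) else false)].

(* A region of the complement of the diagram is a disc if and only if its
   boundary is a single closed walk. *)
Definition disc_region x : bool :=
  [forall y, same_region x y ==> fconnect boundary x y].

(* An under end [x = (v, p)], p = 0 or 2, determines a picture of the crossing
   [v] as a negative crossing sigma, whose negative smoothing is made of two
   vertical arcs: the ends p, p + 1, p + 2, p + 3 of [v] are drawn at the SW,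
   SE, NE, NW corners.  [stacked x y] means that in these pictures the crossing
   of [y] is on top of the crossing of [x], the two strands between them
   enclosing a bigon. *)
Definition stacked : rel (dart D) :=
  [rel x y | [&& joined (turn x 2) (turn y 1), joined (turn x 3) y
               & disc_region (turn x 2)]].

(* The crossings of a twist region are listed from bottom to top. *)
Definition negative_twist_region (s : seq (dart D)) : bool :=
  [&& s != [::], all (fun x => crossing_end x && ~~ over x) s,
      uniq [seq x.1 | x <- s] & sorted stacked s].

Definition maximal_negative_twist_region (s : seq (dart D)) : Prop :=
  negative_twist_region s /\
  forall t, negative_twist_region t ->
    {subset [seq x.1 | x <- s] <= [seq x.1 | x <- t]} -> (size t <= size s)%N.

End Diagram.

(** * The diagrams L(k_1, ..., k_r) *)

(* A diagram in which [r] further vertices, the slots, stand for two-strand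
   tangles yet to be inserted.  The ends 0, 1, 2, 3 of a slot are at its SW, SE,
   NE, NW corners. *)
Record twist_diagram (r : nat) := TwistDiagram {
  rest : finType;
  outline : shadow (rest + 'I_r)%type;
  rest_kind : rest -> option bool }.

Section Fill.
Variables (r : nat) (L : twist_diagram r) (m : 'I_r -> nat).

(* The tangle sigma^(m i) in the slot [i] consists of the vertices
   [fill_slot j] with [j : 'I_(m i).-1.+1], numbered from bottom to
   top.  There are [m i] crossings, or a single negatively smoothed vertex if [m i = 0]. *)
Definition fill_vertex : finType :=
  (rest L + {i : 'I_r & 'I_(m i).-1.+1})%type.

Definition fill_slot (i : 'I_r) (j : 'I_(m i).-1.+1) : fill_vertex :=
  inr (Tagged (fun i => 'I_(m i).-1.+1) j).

Definition fill_kind (v : fill_vertex) : option bool :=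
  match v with
  | inl w => rest_kind w
  | inr u => if m (tag u) == 0%N then Some false else None
  end.

Definition attach (x : (rest L + 'I_r) * 'I_4) : fill_vertex * 'I_4 :=
  match x.1 with
  | inl w => (inl w, x.2)
  | inr i => (@fill_slot i (if (x.2 < 2)%N then ord0 else ord_max), x.2)
  end.

(* the partial inverse of [attach] *)
Definition detach (x : fill_vertex * 'I_4) : option ((rest L + 'I_r) * 'I_4) :=
  match x.1 with
  | inl w => Some (inl w, x.2)
  | inr (existT i j) =>
      if j == (if (x.2 < 2)%N then ord0 else ord_max)
      then Some (inr i, x.2) else None
  end.

(* The NW and NE ends of a vertex of the tangle are connected to the SW and SE
   ends of the next one. *)
Definition inner_edge (x : fill_vertex * 'I_4) : fill_vertex * 'I_4 :=
  match x.1 with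
  | inl w => x
  | inr (existT i j) =>
      (@fill_slot i (inord (if (x.2 < 2)%N then j.-1 else j.+1)), rev_ord x.2)
  end.

Definition fill_edge (x : fill_vertex * 'I_4) : fill_vertex * 'I_4 :=
  if detach x is Some y then attach (edge (outline L) y) else inner_edge x.

Lemma attachK x : detach (attach x) = Some x.
Proof. by case: x => [[w|i] p]; rewrite /attach /detach //=; case: ifP; rewrite eqxx. Qed.

Lemma detachK x y : detach x = Some y -> attach y = x.
Proof.
case: x => [[w|[i j]] p]; rewrite /detach /=; first by case=> <-.
by case: ifP => // /eqP-> [<-].
Qed.

Lemma inner_edgeP x : detach x = None ->
  [/\ detach (inner_edge x) = None, inner_edge (inner_edge x) = x
    & inner_edge x != x].
Proof.
case: x => [[w|[i j]] p] //; rewrite /detach /inner_edge /=.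
have p2 : (rev_ord p < 2)%N = ~~ (p < 2)%N by case: p => [[|[|[|[|]]]]].
have pN : rev_ord p != p by case: p {p2} => [[|[|[|[|]]]]].
have xN (u v : fill_vertex) : (u, rev_ord p) != (v, p).
  by apply: contraNneq pN => -[_ ->].
have jm := ltn_ord j; rewrite p2 rev_ordK.
case: ltnP {p2} => _ /=; case: ifP => // /negbT; rewrite -(inj_eq val_inj) /= => j0 _.
  have jlt : (j.-1 < (m i).-1.+1)%N by rewrite (leq_ltn_trans (leq_pred _)).
  split=> //.
    by rewrite -(inj_eq val_inj) /= inordK // ltn_eqF // -ltnS prednK // lt0n.
  congr (fill_slot _, _); apply: val_inj.
  by rewrite /= !inordK // prednK // lt0n.
have jlt : (j.+1 < (m i).-1.+1)%N by rewrite ltnS ltn_neqAle j0 -ltnS.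
split=> //; first by rewrite -(inj_eq val_inj) /= inordK.
by congr (fill_slot _, _); apply: val_inj; rewrite /= !inordK.
Qed.

Lemma fill_edgeK : involutive fill_edge.
Proof.
move=> x; rewrite {2}/fill_edge; case xE: (detach x) => [y|].
  by rewrite /fill_edge attachK edgeK; apply: detachK.
by rewrite /fill_edge; have [-> -> _] := inner_edgeP xE.
Qed.

Lemma fill_edge_neq x : fill_edge x != x.
Proof.
rewrite /fill_edge; case xE: (detach x) => [y|]; last by case: (inner_edgeP xE).
rewrite -(detachK xE); apply: contraNneq (edge_neq (outline L) y) => /(congr1 detach).
by rewrite !attachK => -[->].
Qed.

(* L(m_1, ..., m_r) *)
Definition fill : diagram :=
  Diagram (Shadow fill_edgeK fill_edge_neq) fill_kind.

(* the tangle sigma^(m i), each crossing being pictured as in [stacked] *)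
Definition fill_twist (i : 'I_r) : seq (dart fill) :=
  [seq (fill_slot j, 0) | j : 'I_(m i).-1.+1].

End Fill.

(* Main.v *)
Require Import Defs.
From mathcomp Require Import all_boot all_order all_algebra.
From mathcomp Require Import fraction zify ring.

(**
  In the Temperley-Lieb algebra, sigma^m = A^-m (1 + A^2 g_m e) with
  g_m = sum_(j < m) (-A^4)^j, so <L(m)> is, up to a power of A, a sum over the
  sets S of flipped vertices of a fixed diagram, where a slot counts as one
  vertex and S is empty in the all-negative state.  The term of S is
  delta^N(S) prod_(u in S) A^2 g_(m_u), with N(S) the number of circles.
  Passing from m_i to m_i - 1 changes g_(m_i) by a unit times A^(4 (m_i - 1)).

  A vertex is good if flipping it in the all-negative state merges two
  circles.  For a nonempty set S of good vertices the lowest degree of the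
  term of S exceeds that of the empty set by at least 4, hence the empty set
  gives the leading coefficient and the two sums agree on 4k coefficients.

  Any other vertex v is nugatory.  Alternation makes the two arcs at v bound
  one and the same region, so a closed curve meets the diagram in v only, and
  it separates the sphere.  Hence flipping v always adds a circle, and
  summing over its two states yields the monomial factor (-A^4)^(m_v).  The
  separation comes from Euler's formula: it forces every Z/2-cocycle of the
  map on the sphere to be a coboundary.
*)

Set Implicit Arguments.
Unset Strict Implicit.
Unset Printing Implicit Defensive.

Import Order.TTheory GRing.Theory Num.Theory.

(** * Counting connected components *)

Lemma connect_invariant (T : finType) (C : eqType) (e : rel T) (g : T -> C) :
  (forall x y, e x y -> g x = g y) -> forall x y, connect e x y -> g x = g y.
Proof.
move=> eg x _ /connectP[p ep ->].
by elim: p x ep => //= y p IHp x /andP[/eg-> /IHp].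
Qed.

Lemma n_comp_kernel (T T' : finType) (e : rel T) (f : T -> T') :
  (forall x y, connect e x y = (f x == f y)) -> n_comp e predT = #|codom f|.
Proof.
move=> ef; have sym_e : connect_sym e by move=> x y; rewrite !ef eq_sym.
have fr x : f (fingraph.root e x) = f x.
  by apply/esym/eqP; rewrite -ef connect_root.
rewrite /n_comp_mem -(card_in_image (f := f)) => [|x y].
  apply: eq_card => z; apply/imageP/codomP => [[x _ ->]|[x ->]]; first by exists x.
  by exists (fingraph.root e x); rewrite ?fr // !inE andbT roots_root.
rewrite !inE !andbT => /eqP rx /eqP ry fxy.
by rewrite -rx -ry; apply/(fingraph.rootP sym_e); rewrite ef fxy.
Qed.

(** [g] and [h] are inverse to each other up to connectivity, so they induce inverse bijections of
    components. This compares relations on different sets of darts. *)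
Lemma n_comp_equiv (T T' : finType) (e : rel T) (e' : rel T')
    (g : T -> T') (h : T' -> T) :
    connect_sym e -> connect_sym e' ->
    (forall x y, e x y -> connect e' (g x) (g y)) ->
    (forall x y, e' x y -> connect e (h x) (h y)) ->
    (forall x, connect e (h (g x)) x) ->
    (forall y, connect e' (g (h y)) y) ->
  n_comp e predT = n_comp e' predT.
Proof.
move=> sym_e sym_e' eg eh hg gh.
have eg' x y : connect e x y -> fingraph.root e' (g x) = fingraph.root e' (g y).
  by apply: (connect_invariant (g := fingraph.root e' \o g)) => u v /eg /(fingraph.rootP sym_e').
have eh' x y : connect e' x y -> fingraph.root e (h x) = fingraph.root e (h y).
  by apply: (connect_invariant (g := fingraph.root e \o h)) => u v /eh /(fingraph.rootP sym_e).
rewrite (n_comp_kernel (f := fingraph.root e' \o g)) => [|x y]; last first.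
  apply/idP/eqP => [/eg' //|/(fingraph.rootP sym_e')/eh' /(fingraph.rootP sym_e) hgxy].
  apply: connect_trans (hg y); apply: connect_trans hgxy.
  by rewrite sym_e hg.
rewrite (n_comp_kernel (f := fingraph.root e')); last by move=> x y; rewrite root_connect.
apply: eq_card => z; apply/codomP/codomP => -[x ->]; first by exists (g x).
by exists (h x); apply/esym/(fingraph.rootP sym_e')/gh.
Qed.

Section Link.
Variables (T : finType) (e : rel T) (sym_e : connect_sym e).

Definition link a b : rel T :=
  [rel x y | [|| e x y, (x == a) && (y == b) | (x == b) && (y == a)]].

Lemma link_sym a b : connect_sym (link a b).
Proof.
apply: symmetric_from_pre => x _ /connectP[p + ->].
elim: p x => //= y p IHp x /andP[exy /IHp py]; apply: connect_trans py _.
have sub : subrel (connect e) (connect (link a b)).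
  by apply: connect_sub => u v uv; apply: connect1; rewrite /link /= uv.
case/or3P: exy => [exy|/andP[/eqP-> /eqP->]|/andP[/eqP-> /eqP->]].
- by apply: sub; rewrite sym_e connect1.
- by apply: connect1; rewrite /link /= !eqxx !orbT.
by apply: connect1; rewrite /link /= !eqxx !orbT.
Qed.

(** A kernel map for [link a b]: the class of [b] is renamed to that of [a]. *)
Definition link_root a b x :=
  if fingraph.root e x == fingraph.root e b then fingraph.root e a else fingraph.root e x.

Lemma connect_link a b x y :
  connect (link a b) x y = (link_root a b x == link_root a b y).
Proof.
have sub : subrel (connect e) (connect (link a b)).
  by apply: connect_sub => u v uv; apply: connect1; rewrite /link /= uv.
have lab : connect (link a b) b a by apply: connect1; rewrite /link /= !eqxx !orbT.
have to_root z : connect (link a b) z (link_root a b z).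
  rewrite /link_root; case: eqP => [/(fingraph.rootP sym_e)/sub zb|_].
    by apply: connect_trans zb (connect_trans lab _); apply/sub/connect_root.
  exact/sub/connect_root.
apply/idP/eqP => [|xy]; last first.
  by apply: connect_trans (to_root x) _; rewrite xy link_sym.
apply: connect_invariant => {x y} x y.
case/or3P => [/connect1/(fingraph.rootP sym_e)|/andP[/eqP-> /eqP->]|/andP[/eqP-> /eqP->]].
- by rewrite /link_root => ->.
- by rewrite /link_root eqxx; case: eqP.
by rewrite /link_root eqxx; case: eqP.
Qed.

(** Linking merges at most two classes: the root of [b] drops out of the image of [link_root]
    exactly when it differs from the root of [a]. *)
Lemma n_comp_link a b :
  n_comp (link a b) predT + (fingraph.root e a != fingraph.root e b) = n_comp e predT.
Proof.
rewrite (n_comp_kernel (connect_link a b)).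
rewrite (n_comp_kernel (f := fingraph.root e)); last by move=> x y; rewrite root_connect.
have [rab|rab] := eqVneq (fingraph.root e a) (fingraph.root e b).
  rewrite addn0; apply: eq_card => z; apply/codomP/codomP => -[x ->].
    by exists x; rewrite /link_root; case: eqP => // ->.
  by exists x; rewrite /link_root; case: eqP => // ->.
rewrite addn1 [RHS](cardD1 (fingraph.root e b)) codom_f add1n; congr _.+1.
apply: eq_card => z; apply/codomP/andP => [[x ->]|[zb /codomP[x zx]]].
  rewrite /link_root; case: (fingraph.root e x =P _) => [_|/eqP xb].
    by rewrite rab codom_f.
  by rewrite xb codom_f.
by exists x; rewrite /link_root -zx (negbTE zb).
Qed.

End Link.

(** * Circles before and after a flip *)

Lemma fpf_involution_even (T : finType) (a : {pred T}) (f : T -> T) :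
    (forall x, x \in a -> f x \in a) ->
    (forall x, x \in a -> f (f x) = x) -> (forall x, x \in a -> f x != x) ->
  ~~ odd #|a|.
Proof.
(* Off [a] the map [f] is arbitrary. Replaced there by the identity, it becomes an involution of [T]
   whose orbits inside [a] have exactly two elements. *)
move=> fa fK f_neq; pose f' x := if x \in a then f x else x.
have f'K : involutive f'.
  by move=> x; rewrite /f'; case: (boolP (x \in a)) => xa; rewrite ?(negbTE xa) // fa ?fK.
rewrite -(@fcard_order_set _ f' (inv_inj f'K) 2) ?oddM ?andbF //; last first.
  apply: intro_closed => [|x _ /eqP<- xa]; first exact: fconnect_sym (inv_inj f'K).
  by rewrite /f' xa fa.
apply/subsetP => x xa; rewrite inE /order.
rewrite -(_ : #|pred2 x (f' x)| = 2); last by rewrite card2 /f' xa eq_sym f_neq.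
apply/eqP/eq_card => y; rewrite !inE.
apply/idP/orP => [/iter_findex<-|[/eqP->|/eqP->]]; last exact: fconnect1.
  elim: (findex _ _ _) => [|n /= [/eqP->|/eqP->]]; rewrite ?eqxx; auto.
  by rewrite f'K eqxx; auto.
exact: connect0.
Qed.

Section Flip.
Variables (V : finType) (G : shadow V).
Implicit Types (s : V -> bool) (v : V) (x y : V * 'I_4).

Definition state_arc s x : V * 'I_4 := (x.1, smoothing_arc (s x.1) x.2).

Lemma smoothing_arcK b : involutive (smoothing_arc b).
Proof. by case: b => -[[|[|[|[|]]]]] // lt_p; apply: val_inj. Qed.

Lemma smoothing_arc_neq b p : smoothing_arc b p != p.
Proof. by case: b; case: p => [[|[|[|[|]]]]]. Qed.

Lemma state_arcK s : involutive (state_arc s).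
Proof. by case=> v p; rewrite /state_arc /= smoothing_arcK. Qed.

Lemma state_arc_neq s x : state_arc s x != x.
Proof.
by apply: contraNneq (smoothing_arc_neq (s x.1) x.2) => /(congr1 snd) /= ->.
Qed.

Definition state_rel s : rel (V * 'I_4) :=
  [rel x y | (y == edge G x) || (y == state_arc s x)].

Lemma circlesE s : circles G s = n_comp (state_rel s) predT.
Proof. by []. Qed.

Lemma state_rel_sym s : connect_sym (state_rel s).
Proof.
apply: sym_connect_sym => x y /=.
rewrite /state_rel /= !(eq_sym y) (can2_eq (edgeK G) (edgeK G)).
by rewrite (can2_eq (state_arcK s) (state_arcK s)).
Qed.

(** The strands of the state [s] with the vertex [v] cut out: its four ends are left loose. *)
Definition outer_rel s v : rel (V * 'I_4) :=
  [rel x y | (y == edge G x) || (x.1 != v) && (y == state_arc s x)].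

Lemma outer_rel_sym s v : connect_sym (outer_rel s v).
Proof.
apply: sym_connect_sym => x y /=.
rewrite /outer_rel /= !(eq_sym y) (can2_eq (edgeK G) (edgeK G)); congr orb.
rewrite (can2_eq (state_arcK s) (state_arcK s)).
by case: (x =P state_arc s y) => [->|]; rewrite ?andbF ?andbT.
Qed.

Definition update s v b : V -> bool := fun w => if w == v then b else s w.

Lemma eq_circles s t : s =1 t -> circles G s = circles G t.
Proof.
by move=> st; apply: eq_n_comp; apply: eq_connect => x y /=; rewrite st.
Qed.

(** Either smoothing of [v] glues two arcs to the same outer strands, so the two circle numbers can
    be compared link by link. *)
Lemma circles_link s v b (a := fun p : nat => (v, inord p) : V * 'I_4) :
  circles G (update s v b) =
  n_comp (if b then link (link (outer_rel s v) (a 0) (a 1)) (a 2) (a 3)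
          else link (link (outer_rel s v) (a 1) (a 2)) (a 3) (a 0)) predT.
Proof.
rewrite circlesE; apply: eq_n_comp; apply: eq_connect => x y.
rewrite /state_rel /state_arc /update /=.
transitivity ([|| y == edge G x, (x.1 != v) && (y == state_arc s x)
    | (x.1 == v) && (y == (v, smoothing_arc b x.2))]).
  by case: x => w p; rewrite /state_arc /=; case: (w =P v) => [->|_]; rewrite ?orbF.
case: x => w p /=; have [->{w}|wv] /= := eqVneq w v; last first.
  have N q : ((w, p) == a q) = false by apply: contraNF wv => /eqP[-> _].
  by case: b; rewrite /link /outer_rel /= !N wv !orbF.
case: y => w q; have [->{w}|wv] := eqVneq w v; last first.
  have N q' : ((w, q) == a q') = false by apply: contraNF wv => /eqP[-> _].
  have -> : ((w, q) == (v, smoothing_arc b p)) = false.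
    by apply: contraNF wv => /eqP[-> _].
  by case: b; rewrite /link /outer_rel /= !N eqxx !andbF !orbF.
have E (p' q' : 'I_4) : ((v, p') == (v, q')) = (p' == q').
  by apply/eqP/eqP => [[]|->].
have I (i : nat) : (i < 4)%N -> \val (inord i : 'I_4) = i by exact: inordK.
by case: b; rewrite /link /outer_rel /= /a !E eqxx /= -!(inj_eq val_inj) !I //;
  case: (_ == edge G _); case: p q => [[|[|[|[|//]]]] ?] [[|[|[|[|//]]]] ?].
Qed.

End Flip.

Lemma n_comp_link2 (T : finType) (e : rel T) a b c d : connect_sym e ->
  n_comp (link (link e a b) c d) predT
    + (link_root e a b c != link_root e a b d)
    + (fingraph.root e a != fingraph.root e b) = n_comp e predT.
Proof.
move=> sym_e; rewrite -(n_comp_link sym_e a b); congr (_ + _).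
rewrite -(n_comp_link (link_sym sym_e a b) c d) root_connect; last exact: link_sym.
by rewrite connect_link.
Qed.

Section FlipCircles.
Variables (V : finType) (G : shadow V).
Implicit Types (s : V -> bool) (v : V).

(** Parity: [K], the outer component of the end [p], is a union of edges, hence even, and its darts
    away from [v] are paired by state arcs. So [K] contains an even number of ends of [v]. *)
Lemma outer_pair s v (p : 'I_4) :
  exists2 q, q != p & connect (outer_rel G s v) (v, p) (v, q).
Proof.
pose K := [pred x | connect (outer_rel G s v) (v, p) x].
have K1 : ~~ odd #|K|.
  apply: (fpf_involution_even (f := edge G)) => [x|x _|x _].
  - by rewrite !inE => /connect_trans; apply; apply: connect1; rewrite /outer_rel /= eqxx.
  - exact: edgeK.
  exact: edge_neq.
pose N := [pred x : V * 'I_4 | x.1 != v].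
have K2 : ~~ odd #|[predI K & N]|.
  apply: (@fpf_involution_even _ [predI K & N] (state_arc s)) => [x|x _|x _].
  - rewrite !inE => /andP[Kx xv]; rewrite xv andbT.
    by apply: connect_trans Kx (connect1 _); rewrite /outer_rel /= xv eqxx orbT.
  - exact: state_arcK.
  exact: state_arc_neq.
have : odd #|[predD K & N]| = false.
  by apply/negbTE; move: K1; rewrite -(cardID N K) oddD (negbTE K2).
have vp : (v, p) \in [predD K & N] by rewrite !inE /= eqxx connect0.
rewrite (cardD1 (v, p)) vp /= => /negbFE/odd_gt0/card_gt0P[[w q]].
rewrite !inE /= => /and3P[qp /negPn/eqP wv Kq]; subst w.
by exists q => //; apply: contraNneq qp => ->.
Qed.

Lemma circles_flip_le s v :
  circles G (update s v true) <= (circles G (update s v false)).+1.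
Proof.
rewrite !circles_link /=; have sym_o := outer_rel_sym G s v.
move: (n_comp_link2 (v, inord 0) (v, inord 1) (v, inord 2) (v, inord 3) sym_o).
move: (n_comp_link2 (v, inord 1) (v, inord 2) (v, inord 3) (v, inord 0) sym_o).
rewrite /link_root.
move: (fingraph.root _ (v, inord 0)) (fingraph.root _ (v, inord 1)).
move: (fingraph.root _ (v, inord 2)) (fingraph.root _ (v, inord 3)) => r2 r3 r0 r1.
(* Each circle number is the number of outer components minus the number of merging links. If a
   positive arc merges, at least one is lost, against at most two on the negative side. If none
   does, the second negative arc does not merge either. *)
have [<-|_] := eqVneq r0 r1; last first.
  by do 2![case: (_ != _)] => /=; lia.
have -> x : (if x == r0 then r0 else x) = x by case: eqP.
have -> x : (if x == r0 then r0 else x) = x by case: eqP.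
have [_|_] := eqVneq r2 r3; last by do 2![case: (_ != _)] => /=; lia.
by rewrite if_same; case: (r0 != r2) => /=; rewrite ?eqxx /=; lia.
Qed.

(** The colouring [g] keeps the ends 0, 1 of [v] apart from 2, 3, so the outer strands pair 0 with 1
    and 2 with 3. The positive arcs then close two circles, the negative ones a single circle. *)
Lemma circles_flip_up s v (C : eqType) (g : V * 'I_4 -> C) :
    (forall x, g (edge G x) = g x) ->
    (forall x, x.1 != v -> g (state_arc s x) = g x) ->
    (forall p q : 'I_4, (g (v, p) == g (v, q)) = ((p < 2) == (q < 2))) ->
  circles G (update s v true) = (circles G (update s v false)).+1.
Proof.
move=> ge ga gv; rewrite !circles_link /=; have sym_o := outer_rel_sym G s v.
have go : forall x y, connect (outer_rel G s v) x y -> g x = g y.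
  by apply: connect_invariant => x y /orP[/eqP->|/andP[/ga gx /eqP->]].
have {}go (p q : 'I_4) : connect (outer_rel G s v) (v, p) (v, q) ->
  (p < 2) = (q < 2) by move/go/eqP; rewrite gv => /eqP.
have r01 : connect (outer_rel G s v) (v, inord 0) (v, inord 1).
  have [q q0 /[dup] /go] := outer_pair s v (inord 0).
  move: q0; rewrite -(inj_eq val_inj) /= inordK //.
  by case: q => [[|[|[|[|]]]]] //= lt _ _; congr connect; congr pair; apply: val_inj;
    rewrite /= ?inordK.
have r23 : connect (outer_rel G s v) (v, inord 2) (v, inord 3).
  have [q q0 /[dup] /go] := outer_pair s v (inord 2).
  move: q0; rewrite -(inj_eq val_inj) /= inordK //.
  by case: q => [[|[|[|[|]]]]] //= lt _ _; congr connect; congr pair; apply: val_inj;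
    rewrite /= ?inordK.
have r02 : ~~ connect (outer_rel G s v) (v, inord 0) (v, inord 2).
  by apply/negP => /go; rewrite !inordK.
move: (n_comp_link2 (v, inord 0) (v, inord 1) (v, inord 2) (v, inord 3) sym_o).
move: (n_comp_link2 (v, inord 1) (v, inord 2) (v, inord 3) (v, inord 0) sym_o).
move: r01 r23 r02; rewrite -!(root_connect sym_o) /link_root => /eqP-> /eqP->.
by move=> r; rewrite !eqxx if_same eqxx r /=; lia.
Qed.

(** When the two negative arcs at [v] lie on different circles, the outer strands pair 1 with 2 and
    0 with 3; the positive arcs join these two circles into one. *)
Lemma circles_flip_down s v :
    ~~ s v -> ~~ connect (state_rel G s) (v, inord 1) (v, inord 0) ->
  (circles G (update s v true)).+1 = circles G (update s v false).
Proof.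
move=> sv; pose d p : V * 'I_4 := (v, inord p).
set x0 := (v, inord 0); set x1 := (v, inord 1).
pose x2 := d 2; pose x3 := d 3 => N.
rewrite !circles_link /= -/x0 -/x1 -/(d 2) -/(d 3) -/x2 -/x3.
have sym_o := outer_rel_sym G s v.
have sub : subrel (connect (outer_rel G s v)) (connect (state_rel G s)).
  apply: connect_sub => x y /orP[|/andP[_]] /eqP->; apply: connect1.
    by rewrite /state_rel /= eqxx.
  by rewrite /state_rel /= eqxx orbT.
have sym_s := state_rel_sym G s.
have arcE (p q : 'I_4) : smoothing_arc false p = q ->
    connect (state_rel G s) (v, p) (v, q).
  by move=> <-; apply: connect1; rewrite /state_rel /state_arc /= (negbTE sv) eqxx orbT.
have c12 : connect (state_rel G s) x1 x2.
  by apply: arcE; apply: val_inj; rewrite /= !inordK.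
have c30 : connect (state_rel G s) x3 x0.
  by apply: arcE; apply: val_inj; rewrite /= !inordK.
have N13 : ~~ connect (state_rel G s) x1 x3.
  by apply: contraNN N => /connect_trans; apply.
have N20 : ~~ connect (state_rel G s) x2 x0.
  by apply: contraNN N => /(connect_trans c12).
have o12 : connect (outer_rel G s v) x1 x2.
  have [q q1 vq] := outer_pair s v (inord 1).
  have sq := sub _ _ vq; move: q1 sq vq; rewrite -(inj_eq val_inj) /= inordK // -/x1.
  case: q => [[|[|[|[|]]]]] //= lt _.
  - by rewrite (_ : Ordinal lt = inord 0) ?(negbTE N) //; apply: val_inj; rewrite /= inordK.
  - by rewrite (_ : Ordinal lt = inord 2) //; apply: val_inj; rewrite /= inordK.
  by rewrite (_ : Ordinal lt = inord 3) ?(negbTE N13) //; apply: val_inj; rewrite /= inordK.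
have o03 : connect (outer_rel G s v) x0 x3.
  have [q q1 vq] := outer_pair s v (inord 0).
  have sq := sub _ _ vq; move: q1 sq vq; rewrite -(inj_eq val_inj) /= inordK // -/x0 sym_s.
  case: q => [[|[|[|[|]]]]] //= lt _.
  - by rewrite (_ : Ordinal lt = inord 1) ?(negbTE N) //; apply: val_inj; rewrite /= inordK.
  - by rewrite (_ : Ordinal lt = inord 2) ?(negbTE N20) //; apply: val_inj; rewrite /= inordK.
  by rewrite (_ : Ordinal lt = inord 3) //; apply: val_inj; rewrite /= inordK.
have o10 : ~~ connect (outer_rel G s v) x1 x0 by apply: contraNN N => /sub.
move: (n_comp_link2 x0 x1 x2 x3 sym_o) (n_comp_link2 x1 x2 x3 x0 sym_o).
move: o12 o03 o10; rewrite -!(root_connect sym_o) /link_root => /eqP-> /eqP->.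
by move=> r; rewrite !eqxx if_same eqxx [_ == fingraph.root _ x2]eq_sym r /=; lia.
Qed.

End FlipCircles.

(** * Circles and regions of an alternating diagram *)

Section Dihedral.
Variables (T : finType) (a b : T -> T).
Hypotheses (aK : involutive a) (bK : involutive b).

(** The iterates of [a \o b] run through a circle in one direction; applying [a] gives the darts met
    in the other direction. *)
Lemma dihedral_orbit x y :
  connect [rel x y | (y == b x) || (y == a x)] x y ->
  fconnect (a \o b) x y || fconnect (a \o b) x (a y).
Proof.
have inj_ab : injective (a \o b) by apply: inj_comp; apply: inv_inj.
pose k z := fconnect (a \o b) x z || fconnect (a \o b) x (a z).
rewrite -/(k y) => xy; suff <- : k x = k y by rewrite /k connect0.
apply: connect_invariant xy => {}y z; rewrite /k => /orP[] /eqP->; last by rewrite aK orbC.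
rewrite -[a (b y)]/((a \o b) y) -same_fconnect1_r // orbC; congr orb.
by rewrite [RHS]same_fconnect1_r //= bK.
Qed.

(** A walk along a circle never meets itself backwards: an equality for [n + 2] at [x] gives one for
    [n] at [a (b x)], and the descent ends at a fixed point of [a] or of [b]. *)
Lemma dihedral_turn_back n x :
  (forall y, a y != y) -> (forall y, b y != y) -> iter n (a \o b) x != b x.
Proof.
move=> aN bN; elim/ltn_ind: n x => -[|[|n]] IHn x /=; first by rewrite eq_sym.
  exact: aN.
apply: contraNneq (IHn n _ ((a \o b) x)) => [abx|]; last exact: leqW.
by rewrite -iterSr /= -abx aK bK.
Qed.

End Dihedral.

Section Alternating.
Variables (D : diagram) (s : vertex D -> bool).
Hypothesis alt_D : alternating D.
Hypothesis s_kind : forall v b, kind v = Some b -> s v = b.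
Hypothesis s_cross : forall v, kind v = None -> s v = false.

Let next := state_arc s \o edge D.

(** [y] is the last crossing end left on the walk, an over end. Only smoothed vertices follow it, so
    alternation forces the next crossing to be entered at an under end. *)
Let under_next z n j (x := iter n next z) (y := iter j next z) : j <= n ->
  crossing_end y -> Defs.over y -> connect (follow (D := D)) y x ->
  crossing_end (edge D x) -> ~~ Defs.over (edge D x).
Proof.
move=> jn cy oy yx ce.
have Ny : y != edge D x.
  have := dihedral_turn_back (state_arcK s) (edgeK D) (n - j) y (state_arc_neq s) (edge_neq D).
  rewrite -/next -iterD subnK // -/x; apply: contraNneq => ->; exact/eqP/esym/edgeK.
have := alt_D; rewrite /alternating => /(_ y (edge D x)).
rewrite /joined cy ce Ny oy /= => -> //.
by apply: connect_trans yx (connect1 _); rewrite /follow /= eqxx.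
Qed.

(** At an under end the negative arc is the left turn, and it leads out along an over end. Hence a
    circle of the base state that once leaves along an over end follows the boundary of a region;
    the invariant remembers the last crossing end left. *)
Lemma over_orbit (z : dart D) n (x := iter n next z) :
    crossing_end z -> Defs.over z ->
  (crossing_end x -> Defs.over x) /\ boundary x = next x.
Proof.
move=> cz oz; rewrite {}/x.
suff [xo [j jn [cy oy yx]]] : let x := iter n next z in
    (crossing_end x -> Defs.over x) /\
    exists2 j, j <= n & let y := iter j next z in
      [/\ crossing_end y, Defs.over y & connect (follow (D := D)) y x].
  split=> //; move: (under_next jn cy oy yx).
  rewrite /boundary /next /state_arc /=.
  move: (edge D _) => {cz oz xo jn cy oy yx} [w p]; rewrite /crossing_end /Defs.over /=.
  case kw: (kind w) => [b|] //=; first by rewrite (s_kind kw).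
  rewrite (s_cross kw) => /(_ isT); case: p => [[|[|[|[|]]]]] //= lt _;
    by congr pair; apply: val_inj.
elim: n => [|n [xo [j jn [cy oy yx]]]]; first by split=> //; exists 0 => //; rewrite connect0.
have := under_next jn cy oy yx.
have yx1 : connect (follow (D := D)) (iter j next z) (edge D (iter n next z)).
  by apply: connect_trans yx (connect1 _); rewrite /follow /= eqxx.
have nE : iter n.+1 next z = state_arc s (edge D (iter n next z)) by [].
rewrite nE; case Ee: (edge D (iter n next z)) yx1 nE => [w p] yx1 nE /=.
case kw: (kind w) => [b|] up.
  split; first by rewrite /crossing_end /= kw.
  exists j; first exact: leqW.
  split=> //; apply: connect_trans yx1 (connect1 _).
  by rewrite /follow /state_arc /= kw (s_kind kw) eqxx orbT.
have ov : Defs.over (state_arc s (w, p)).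
  move: up; rewrite /state_arc /crossing_end /Defs.over /= kw (s_cross kw) => /(_ isT).
  by case: p {Ee yx1 nE} => [[|[|[|[|]]]]].
split=> //; exists n.+1; rewrite // nE.
by split; [rewrite /crossing_end /= kw|exact: ov|exact: connect0].
Qed.

(** The walk that starts along the over end 1 leaves crossings along over ends only. It therefore
    cannot leave [v] along 0 and leaves along the partner 3 instead, having stayed on the boundary
    of one region. *)
Lemma same_region_circle v : kind v = None ->
  connect (state_rel D s) (v, inord 1) (v, inord 0) ->
  same_region (v, inord 1) (v, inord 3).
Proof.
move=> kv /(dihedral_orbit (state_arcK s) (edgeK D)).
have c1 : crossing_end (v, inord 1 : 'I_4) by rewrite /crossing_end /= kv.
have o1 : Defs.over (v, inord 1 : 'I_4) by rewrite /Defs.over /= inordK.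
case/orP => /iter_findex; move: (findex _ _ _) => n xn.
  have [] := over_orbit n c1 o1; rewrite -/next in xn; rewrite xn /crossing_end /Defs.over /= kv.
  by move/(_ isT); rewrite inordK.
have -> : (v, inord 3 : 'I_4) = iter n next (v, inord 1).
  rewrite /next xn /state_arc /= (s_cross kv); congr pair; apply: val_inj.
  by rewrite /= !inordK.
elim: n {xn} => [|n IHn]; first exact: connect0.
apply: connect_trans IHn (connect1 _); rewrite /= -/next.
by have [_ ->] := over_orbit n c1 o1; rewrite /next /= eqxx.
Qed.

End Alternating.

(** * Exactness over F_2 on the sphere *)

(** Rank count: both kernels have dimension at most one, so the ranks of [N] and [M] are at least
    [#|I| - 1] and [#|K| - 1], and the bound on [#|J|] makes the kernel of [M] no larger than the
    row space of [N], which it contains. *)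
Lemma exact_of_rank (F : fieldType) (I J K : finType)
    (n : I -> J -> F) (m : J -> K -> F) :
    (forall i k, (\sum_j n i j * m j k = 0)%R) ->
    (forall u, (forall j, (\sum_i u i * n i j = 0)%R) -> forall i i', u i = u i') ->
    (forall w, (forall j, (\sum_k m j k * w k = 0)%R) -> forall k k', w k = w k') ->
    #|J| + 2 <= #|I| + #|K| ->
  forall X, (forall k, (\sum_j X j * m j k = 0)%R) ->
  exists U, forall j, (X j = \sum_i U i * n i j)%R.
Proof.
move=> nm0 kerN kerM IJK X Xm0.
pose N := (\matrix_(i < #|I|, j < #|J|) n (enum_val i) (enum_val j))%R.
pose M := (\matrix_(j < #|J|, k < #|K|) m (enum_val j) (enum_val k))%R.
have sumE (T : finType) (f : T -> F) : (\sum_(i < #|T|) f (enum_val i) = \sum_t f t)%R.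
  by rewrite [RHS](reindex _ (onW_bij _ (enum_val_bij T))).
have rank_ker_le1 (T T' : finType) (B : 'M[F]_(#|T|, #|T'|)) :
    (forall u : T -> F, (forall j, \sum_i u i * B (enum_rank i) j = 0)%R ->
       forall i i', u i = u i') -> #|T| <= (\rank B).+1.
  move=> kerB; suff : \rank (kermx B) <= 1 by rewrite mxrank_ker; lia.
  apply: leq_trans (rank_leq_row (const_mx 1%R : 'rV[F]_#|T|)).
  apply/mxrankS/row_subP => i; have := row_mul i (kermx B) B.
  rewrite mulmx_ker row0; move: (row i (kermx B)) => r /esym rB.
  apply/sub_rVP; have [t _|T0] := pickP T; last first.
    by exists 0%R; apply/rowP => j; have := T0 (enum_val j).
  exists (r 0%R (enum_rank t)); apply/rowP => j; rewrite !mxE mulr1.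
  rewrite -[j]enum_valK; apply: (kerB (fun t => r 0%R (enum_rank t))) => k.
  transitivity ((r *m B) 0 k)%R; last by rewrite rB mxE.
  by rewrite mxE -[LHS]sumE; apply: eq_bigr => l _; rewrite enum_valK.
have rN : #|I| <= (\rank N).+1.
  apply: rank_ker_le1 => u uN; apply: kerN => j; rewrite -[RHS](uN (enum_rank j)).
  by apply: eq_bigr => i _; rewrite mxE !enum_rankK.
have rM : #|K| <= (\rank M).+1.
  rewrite -mxrank_tr; apply: rank_ker_le1 => w wM; apply: kerM => j.
  rewrite -[RHS](wM (enum_rank j)); apply: eq_bigr => k _.
  by rewrite !mxE !enum_rankK mulrC.
have NM : (N <= kermx M)%MS.
  apply/sub_kermxP/matrixP => i k; rewrite !mxE -[RHS](nm0 (enum_val i) (enum_val k)) -[RHS]sumE.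
  by apply: eq_bigr => j _; rewrite !mxE.
have MN : (kermx M <= N)%MS.
  rewrite -(geq_leqif (mxrank_leqif_sup NM)) mxrank_ker; lia.
have : ((\row_j X (enum_val j))%R <= N)%MS.
  apply: submx_trans MN; apply/sub_kermxP/rowP => k.
  rewrite !mxE -[RHS](Xm0 (enum_val k)) -[RHS]sumE.
  by apply: eq_bigr => j _; rewrite !mxE.
case/submxP => U XU; exists (fun i => U 0%R (enum_rank i)) => j.
have /rowP/(_ (enum_rank j)) := XU; rewrite !mxE enum_rankK => ->; rewrite -[RHS]sumE.
by apply: eq_bigr => i _; rewrite !mxE enum_valK enum_rankK.
Qed.

Local Open Scope ring_scope.

Lemma addF2 (a : 'F_2) : a + a = 0.
Proof. by apply: val_inj; case: a => [[|[|]]]. Qed.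

Lemma addF2_eq0 (a b : 'F_2) : a + b = 0 -> a = b.
Proof. by move=> ab; rewrite -[a]addr0 -(addF2 b) addrA ab add0r. Qed.

Lemma sum_delta (R : nzRingType) (T : finType) (f : T -> R) t :
  \sum_u f u * (u == t)%:R = f t.
Proof.
rewrite (bigD1 t) //= eqxx mulr1 big1 ?addr0 // => u /negbTE->.
by rewrite mulr0.
Qed.

Section Cohomology.
Variables (V : finType) (G : shadow V).

Lemma edge_orbit x y : fconnect (edge G) x y = (y == x) || (y == edge G x).
Proof.
apply/idP/orP => [/iter_findex<-|[/eqP->|/eqP->]]; last exact: fconnect1.
  elim: (findex _ _ _) => [|n /= [/eqP->|/eqP->]]; rewrite ?eqxx; auto.
  by rewrite edgeK eqxx; auto.
exact: connect0.
Qed.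

Lemma froots_edge x : froots (edge G) (edge G x) = ~~ froots (edge G) x.
Proof.
have inj_e := inv_inj (edgeK G).
have rx : froot (edge G) (edge G x) = froot (edge G) x.
  by apply/esym/eqP; rewrite root_connect ?fconnect1 //; apply: fconnect_sym.
rewrite /roots rx; have := connect_root (frel (edge G)) x.
rewrite edge_orbit => /orP[] /eqP->; first by rewrite eqxx eq_sym (negbTE (edge_neq G x)).
by rewrite eqxx edge_neq.
Qed.

Lemma face_inj : injective (face G).
Proof.
move=> x y /(congr1 (fun z => turn z 1)); rewrite /face /turn /= !subrK -!surjective_pairing.
exact: (inv_inj (edgeK G)).
Qed.

Definition edge_rep : finType := {x in froots (edge G)}.
Definition face_rep : finType := {x : V * 'I_4 | froots (face G) x}.

Lemma card_edge_rep : #|edge_rep| = fcard (edge G) predT.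
Proof. by rewrite card_sig; apply: eq_card => x; rewrite !inE andbT. Qed.

Lemma card_face_rep : #|face_rep| = fcard (face G) predT.
Proof. by rewrite card_sig; apply: eq_card => x; rewrite !inE andbT. Qed.

Definition face_of x : face_rep :=
  exist _ (froot (face G) x) (roots_root (fconnect_sym face_inj) x).

Lemma face_of_eq x y : (face_of x == face_of y) = fconnect (face G) x y.
Proof.
by rewrite -(inj_eq val_inj) /= root_connect //; apply: fconnect_sym face_inj.
Qed.

Lemma face_of_face x : face_of (face G x) = face_of x.
Proof. by apply/esym/eqP; rewrite face_of_eq fconnect1. Qed.

Lemma edge_sum (R : nmodType) (h : V * 'I_4 -> R) :
  \sum_(e : edge_rep) (h (val e) + h (edge G (val e))) = \sum_x h x.
Proof.
rewrite [RHS](bigID (froots (edge G))) /= [X in _ = _ + X](reindex_inj (inv_inj (edgeK G))).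
rewrite [X in _ = _ + X](eq_bigl (froots (edge G))) => [|x]; last first.
  by rewrite froots_edge negbK.
by rewrite -big_split /= [RHS](big_sub (froots (edge G))).
Qed.

Lemma spherical_connected (x : V * 'I_4) : spherical G -> components G = 1%N.
Proof.
case=> C1 _; apply/eqP; rewrite eqn_leq C1 /=; apply/card_gt0P.
exists (fingraph.root [rel x y : V * 'I_4 | (y == edge G x) || (y.1 == x.1)] x).
rewrite !inE andbT; apply: roots_root; apply: sym_connect_sym => y z /=.
by rewrite [y.1 == _]eq_sym [y == _]eq_sym (can2_eq (edgeK G) (edgeK G)).
Qed.

Lemma spherical_constant (C : eqType) (f : V * 'I_4 -> C) : spherical G ->
    (forall x, f (edge G x) = f x) -> (forall x, f (turn x (- 1)) = f x) ->
  forall x y, f x = f y.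
Proof.
move=> [C1 _] fe ft x y.
set R := [rel x y : V * 'I_4 | (y == edge G x) || (y.1 == x.1)].
have symR : connect_sym R.
  apply: sym_connect_sym => {}y z /=.
  by rewrite [y.1 == _]eq_sym [y == _]eq_sym (can2_eq (edgeK G) (edgeK G)).
apply: (connect_invariant (e := R)) => [{}x {}y /orP[/eqP->|/eqP xy]|].
- by rewrite fe.
- have f0 v (p : 'I_4) : f (v, p) = f (v, 0).
    have step (q q' : 'I_4) : q - 1 = q' -> f (v, q) = f (v, q').
      by move=> <-; rewrite -ft.
    have s1 := step 1 0 (subrr _); have s2 := step 2 1 (addrK _ _).
    have s3 : f (v, 3) = f (v, 2) by apply: step; apply: val_inj.
    case: p => [[|[|[|[|//]]]] lt].
    + by congr (f (_, _)); apply: val_inj.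
    + by rewrite -s1; congr (f (_, _)); apply: val_inj.
    + by rewrite -s1 -s2; congr (f (_, _)); apply: val_inj.
    by rewrite -s1 -s2 -s3; congr (f (_, _)); apply: val_inj.
  by case: x y xy => v p [w q] /= ->; rewrite f0 [RHS]f0.
have /card_le1_eqP r1 := C1; apply/(fingraph.rootP symR).
by apply: r1; rewrite !inE andbT roots_root.
Qed.

(** [X] is a 1-cocycle and [U] a potential for it: the first cohomology of the sphere over F_2
    vanishes. In the proof [n] and [m] are the vertex-edge and edge-face incidences, and
    connectedness bounds both kernels. *)
Lemma spherical_exact (X : V * 'I_4 -> 'F_2) : spherical G ->
    (forall x, X (edge G x) = X x) ->
    (forall z, \sum_(x | fconnect (face G) z x) X x = 0) ->
  exists U : V -> 'F_2, forall x, X x = U x.1 + U (edge G x).1.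
Proof.
move=> sphG Xe Xf; have [v0 _|v0] := pickP V; last first.
  by exists (fun=> 0) => x; have := v0 x.1.
pose n (v : V) (e : edge_rep) : 'F_2 :=
  (v == (val e).1)%:R + (v == (edge G (val e)).1)%:R.
pose m (e : edge_rep) (f : face_rep) : 'F_2 :=
  (f == face_of (val e))%:R + (f == face_of (edge G (val e)))%:R.
have all_edges (P : V * 'I_4 -> Prop) :
    (forall x, P x -> P (edge G x)) -> (forall e : edge_rep, P (val e)) -> forall x, P x.
  move=> Pe Pr x; have [rx|rx] := boolP (froots (edge G) x).
    exact: (Pr (exist _ x rx)).
  rewrite -(edgeK G x); apply: Pe; rewrite -froots_edge in rx.
  exact: (Pr (exist _ (edge G x) rx)).
have nE (U : V -> 'F_2) e :
    \sum_v U v * n v e = U (val e).1 + U (edge G (val e)).1.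
  by under eq_bigr do rewrite mulrDr; rewrite big_split /= !sum_delta.
have euler : (#|edge_rep| + 2 <= #|V| + #|face_rep|)%N.
  have [_] := sphG; rewrite (spherical_connected (v0, 0) sphG).
  by rewrite -card_edge_rep -card_face_rep => ->; rewrite leqnn.
have [|||||U XU] := @exact_of_rank _ V edge_rep face_rep n m _ _ _ _ (fun e => X (val e)).
(* A walk around a face leaves a vertex as often as it enters it: reindexing by [face] turns the
   first half of the sum into the second. *)
- move=> v f; pose H x : 'F_2 := ((v == x.1)%:R + (v == (edge G x).1)%:R) * (f == face_of x)%:R.
  rewrite (eq_bigr (fun e : edge_rep => H (val e) + H (edge G (val e)))) => [|e _].
    rewrite edge_sum /H; under eq_bigr do rewrite mulrDl.
    rewrite big_split /= [X in X + _](reindex_inj face_inj) /=.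
    under eq_bigr do rewrite face_of_face.
    exact: addF2.
  by rewrite /n /m /H edgeK mulrDr [X in _ = _ + X * _]addrC.
- move=> u u0 v w.
  apply: (@spherical_constant _ (fun x => u x.1) _ _ _ (v, 0) (w, 0)) => // x.
  apply/esym; move: x; apply: all_edges => [x ux|e]; first by rewrite edgeK ux.
  by apply: addF2_eq0; rewrite -nE.
- move=> w w0 f f'.
  have we x : w (face_of (edge G x)) = w (face_of x).
    apply/esym; move: x; apply: all_edges => [x ux|e]; first by rewrite edgeK ux.
    apply: addF2_eq0; rewrite -[RHS](w0 e) /m; under [RHS]eq_bigr do rewrite mulrC mulrDr.
    by rewrite big_split /= !sum_delta.
  have wt x : w (face_of (turn x (- 1))) = w (face_of x).
    by rewrite -[in LHS](edgeK G x) -/(face G _) face_of_face we.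
  have fE (g : face_rep) : g = face_of (val g).
    by apply: val_inj; case: g => x rx; apply/esym/eqP.
  rewrite (fE f) (fE f').
  by have := @spherical_constant _ (fun x => w (face_of x)) sphG we wt; apply.
- exact: euler.
- move=> f; pose H x := X x * (f == face_of x)%:R.
  rewrite (eq_bigr (fun e : edge_rep => H (val e) + H (edge G (val e)))) => [|e _].
    rewrite edge_sum /H -[RHS](Xf (val f)) [RHS]big_mkcond; apply: eq_bigr => x _.
    have -> : fconnect (face G) (val f) x = (f == face_of x).
      rewrite -face_of_eq; congr (_ == _); apply: val_inj.
      by case: f {H} => y ry; apply/eqP.
    by case: eqP; rewrite ?mulr1 ?mulr0.
  by rewrite /H /m Xe mulrDr.
exists U; apply: all_edges => [x Xx|e]; first by rewrite Xe Xx edgeK addrC.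
by rewrite XU nE.
Qed.

End Cohomology.

(** * Curves inside a region *)

Section Jordan.
Variable D : diagram.
Implicit Types x y z c : dart D.

(** At a smoothed vertex two opposite corners are not cut off by an arc; a curve inside a region may
    pass from one to the other. *)
Definition merged x : bool :=
  if kind x.1 is Some b then smoothing_arc b x.2 != x.2 + 1 else false.

(** The merged corners at the vertex of [x] are [x] and the opposite one; the left side counts mod 2
    how many of them lie in the face of [z]. *)
Lemma region_jump x z : merged x ->
  \sum_(c | fconnect (face D) z c) (merged c)%:R * (c.1 == x.1)%:R =
  (fconnect (face D) z x)%:R + (fconnect (face D) z (turn x 2))%:R :> 'F_2.
Proof.
move=> mx; have cE c : merged c && (c.1 == x.1) = (c == x) || (c == turn x 2).
  case: x c mx {z} => v p [w q]; rewrite /merged /turn /=.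
  have [->|wv] := eqVneq w v; last first.
    rewrite andbF; symmetry; apply/negbTE; rewrite negb_or.
    by apply/andP; split; apply: contraNneq wv => -[-> _].
  have E (p' q' : 'I_4) : ((v, p') == (v, q')) = (p' == q').
    by apply/eqP/eqP => [[]|->].
  rewrite !E andbT; case: (kind v) => [b|] //.
  by case: b; case: p q => [[|[|[|[|//]]]] ?] [[|[|[|[|//]]]] ?].
have x2 : turn x 2 != x.
  by case: x {mx cE} => v [[|[|[|[|//]]]] ?]; apply/eqP => -[].
rewrite big_mkcond -!(sum_delta (fun c => (fconnect (face D) z c)%:R)) -big_split /=.
apply: eq_bigr => c _; rewrite -mulrDr -natrM mulnb cE.
have -> : ((c == x) || (c == turn x 2))%:R = (c == x)%:R + (c == turn x 2)%:R :> 'F_2.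
  by have [->|] := eqVneq c x; rewrite ?add0r // eq_sym (negbTE x2) addr0.
by case: ifP => _; rewrite ?mul1r ?mul0r.
Qed.

(** Where the arc of a smoothed vertex disagrees with the left turn, the walk turns left and then
    passes to the opposite merged corner. *)
Lemma boundary_jump x :
  boundary x = face D x \/ merged (face D x) /\ boundary x = turn (face D x) 2.
Proof.
rewrite /boundary /face /turn /merged; move: (edge D x) => [v p] /=.
case: (kind v) => [b|]; last by left.
have E (p' q' : 'I_4) : ((v, p') == (v, q')) = (p' == q').
  by apply/eqP/eqP => [[]|->].
suff : (smoothing_arc b p == p - 1) ||
    (smoothing_arc b (p - 1) != p - 1 + 1) && (smoothing_arc b p == p - 1 + 2).
  by case/orP=> [/eqP->|/andP[-> /eqP->]]; [left|right].
by case: b; case: p => [[|[|[|[|]]]] ?].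
Qed.

(* A curve inside a region crosses the smoothed vertices only; [t] counts mod 2
   how many times it passes through each of them. *)
Lemma region_chain x y : same_region x y ->
  exists t : vertex D -> 'F_2, forall z,
    \sum_(c | fconnect (face D) z c) (merged c)%:R * t c.1 =
    (fconnect (face D) z x)%:R + (fconnect (face D) z y)%:R.
Proof.
case/connectP => p + ->; elim: p x => [|x' p IHp] x /=.
  by exists (fun=> 0) => z; rewrite addF2 big1 // => c _; rewrite mulr0.
case/andP => xx' /IHp[t tP] {IHp}.
have add_jump u : merged u -> forall z,
    \sum_(c | fconnect (face D) z c) (merged c)%:R * (t c.1 + (c.1 == u.1)%:R) =
    (fconnect (face D) z x')%:R + (fconnect (face D) z (last x' p))%:R +
    ((fconnect (face D) z u)%:R + (fconnect (face D) z (turn u 2))%:R).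
  move=> mu z; rewrite -(region_jump z mu) -tP -big_split /=.
  by apply: eq_bigr => c _; rewrite mulrDr.
have face_step u z : fconnect (face D) z (face D u) = fconnect (face D) z u.
  by rewrite -same_fconnect1_r //; apply: face_inj.
have F2 (a b c : 'F_2) : b + c + (a + b) = a + c.
  by rewrite addrACA [c + b]addrC addrACA [a + c]addrC -[RHS]add0r -(addF2 b) addrCA !addrA.
case/orP: xx' => [/eqP xx'|].
  have [bx|[mx bx]] := boundary_jump x.
    by exists t => z; rewrite tP xx' bx face_step.
  exists (fun v => t v + (v == (face D x).1)%:R) => z.
  by rewrite add_jump // xx' bx face_step F2.
case kx: (kind x.1) => [b|] // /andP[mx /eqP xx'].
exists (fun v => t v + (v == x.1)%:R) => z.
by rewrite add_jump ?xx' ?F2 // /merged kx.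
Qed.

(** A curve inside the region joining the corners 1 and 3 of [v] closes up through [v], and [g]
    tells on which side of it a dart lies. The curve avoids the other crossings and passes between
    the arcs of smoothed vertices, so away from [v] no arc of a state [s] changes sides. *)
Lemma nugatory_coloring v : spherical D -> kind v = None ->
    same_region ((v, inord 1) : dart D) (v, inord 3) ->
  exists g : dart D -> 'F_2,
  [/\ forall x, g (edge D x) = g x,
      forall (s : vertex D -> bool) x, (forall w b, kind w = Some b -> s w = b) ->
        x.1 != v -> g (state_arc s x) = g x
    & forall p q : 'I_4, (g (v, p) == g (v, q)) = ((p < 2)%N == (q < 2)%N)].
Proof.
move=> sphD kv /region_chain[t tP].
(* Sides near a vertex: [h] changes between neighbouring ends exactly when the curve passes an odd
   number of times through the corner between them. *)
pose h (x : dart D) : 'F_2 := if kind x.1 is Some b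
  then t x.1 * ((x.2 == 0) || (x.2 == smoothing_arc b 0))%:R
  else (x.1 == v)%:R * (x.2 < 2)%:R.
have hE x : h x + h (turn x 1) = (merged x)%:R * t x.1 +
    ((x == (v, inord 1))%:R + (x == (v, inord 3))%:R).
  case: x => w p; rewrite /h /merged /turn /=.
  have E (p' q' : 'I_4) : ((w, p') == (v, q')) = (w == v) && (p' == q').
    by apply/eqP/andP => [[-> ->]|[/eqP-> /eqP->]].
  rewrite !E; have [->|wv] /= := eqVneq w v.
    rewrite kv !mul1r mul0r add0r; apply: val_inj.
    by rewrite -!(inj_eq val_inj) /= !inordK //; case: p => [[|[|[|[|]]]] ?].
  case: (kind w) => [b|]; last by rewrite !mul0r !addr0.
  rewrite !addr0 -mulrDr mulrC; congr (_ * _).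
  by case: b; case: p => [[|[|[|[|//]]]] ?]; apply/eqP.
have [|z|U UP] := @spherical_exact _ D (fun x => h x + h (edge D x)) sphD.
- by move=> x; rewrite edgeK addrC.
- rewrite big_split /=.
  (* [edge D x] is the end following [face D x], so the sum over the edges of a face becomes a sum
     over its corners. There the passages of the curve and its two ends at [v] cancel by [tP]. *)
  have -> : \sum_(x | fconnect (face D) z x) h (edge D x) =
      \sum_(x | fconnect (face D) z x) h (turn x 1).
    rewrite [RHS](reindex_inj (@face_inj _ D)) /=; apply: eq_big => x.
      by rewrite -same_fconnect1_r //; apply: face_inj.
    by move=> _; congr h; rewrite /turn /= subrK -surjective_pairing.
  rewrite -big_split /=; under eq_bigr do rewrite hE.
  rewrite big_split /= tP [X in _ + _ + X]big_mkcond /=.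
  rewrite -!(sum_delta (fun c => (fconnect (face D) z c)%:R)) -!big_split /=.
  apply: big1 => c _; case: ifP => _; rewrite ?mul1r ?mul0r ?addr0 //.
  exact: addF2.
exists (fun x => U x.1 + h x); split.
- move=> x; apply: addF2_eq0; rewrite addrACA [h _ + _]addrC [U _ + _]addrC -UP.
  exact: addF2.
- move=> s x s_kind xv; rewrite /state_arc /h /=; congr (_ + _).
  case kw: (kind x.1) => [b|]; last by rewrite (negbTE xv) !mul0r.
  rewrite (s_kind _ _ kw); congr (_ * _); congr (_%:R).
  by case: b {kw}; case: x.2 => [[|[|[|[|]]]] ?].
move=> p q; rewrite /h /= kv eqxx !mul1r (inj_eq (addrI _)).
by case: (_ < 2)%N; case: (_ < 2)%N.
Qed.

End Jordan.

(** * Inserting twists *)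

Local Close Scope ring_scope.

(** * The dichotomy of crossings *)

Definition base_state (D : diagram) (v : vertex D) : bool := odflt false (kind v).

(** Decided by whether the two negative arcs at [v] lie on the same circle of the base state. If so,
    [v] is nugatory and its colouring serves every compatible state; if not, the flip merges two
    circles. *)
Lemma crossing_dichotomy (D : diagram) (v : vertex D) :
    spherical D -> alternating D -> kind v = None ->
  (forall s : vertex D -> bool, (forall w b, kind w = Some b -> s w = b) ->
     circles D (update s v true) = (circles D (update s v false)).+1) \/
  (circles D (update (@base_state D) v true)).+1 =
    circles D (update (@base_state D) v false).
Proof.
move=> sphD altD kv; have base_kind w b : kind w = Some b -> @base_state D w = b.
  by rewrite /base_state => ->.
have base_cross w : kind w = None -> @base_state D w = false.
  by rewrite /base_state => ->.
have [c10|c10] := boolP (connect (state_rel D (@base_state D)) (v, inord 1) (v, inord 0)).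
  left=> s s_kind.
  have [g [ge ga gv]] := nugatory_coloring sphD kv
    (same_region_circle altD base_kind base_cross kv c10).
  by apply: (circles_flip_up ge _ gv) => x xv; apply: ga.
by right; apply: circles_flip_down; rewrite // base_cross.
Qed.

Section FillCircles.
Variables (r : nat) (L : twist_diagram r) (m : 'I_r -> nat).
Implicit Types (s : fill_vertex L m -> bool) (i : 'I_r).

(** Since e e = delta e, a slot behaves like e as soon as one of its vertices is positive. *)
Definition slot_state s : rest L + 'I_r -> bool :=
  fun u => match u with
  | inl w => s (inl w)
  | inr i => [exists j : 'I_(m i).-1.+1, s (fill_slot L j)]
  end.

(* The horizontal level of an end of the vertex [fill_slot j]; the levels of a
   twist run from [0] to [(m i).-1.+1]. *)
Definition level (j : nat) (p : 'I_4) : nat := if p < 2 then j else j.+1.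

Definition cut_below s i (l : nat) : bool :=
  [exists j : 'I_(m i).-1.+1, (j < l) && s (fill_slot L j)].

Lemma cut_below0 s i : cut_below s i 0 = false.
Proof. by apply/existsP => -[]. Qed.

Lemma cut_belowS s i (j : 'I_(m i).-1.+1) :
  cut_below s i j.+1 = cut_below s i j || s (fill_slot L j).
Proof.
apply/existsP/orP => [[j' /andP[]]|[/existsP[j' /andP[j'j sj']]|sj]].
- rewrite ltnS leq_eqVlt => /orP[/eqP/val_inj->|j'j sj']; first by right.
  by left; apply/existsP; exists j'; rewrite j'j.
- by exists j'; rewrite sj' leqW.
by exists j; rewrite sj ltnSn.
Qed.

Lemma cut_below_max s i : cut_below s i (m i).-1.+1 = slot_state s (inr i).
Proof. by apply: eq_existsb => j; rewrite ltn_ord. Qed.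

Lemma level_inner (j : nat) (p : 'I_4) : (p < 2 -> 0 < j) ->
  level (if p < 2 then j.-1 else j.+1) (rev_ord p) = level j p.
Proof.
have -> : level (if p < 2 then j.-1 else j.+1) (rev_ord p) =
    if p < 2 then j.-1.+1 else j.+1.
  by rewrite /level; case: p => [[|[|[|[|]]]]].
by rewrite /level; case: ifP => // _ /(_ isT) /prednK.
Qed.

Lemma inner_edgeE i (j : 'I_(m i).-1.+1) (p : 'I_4) :
    detach (fill_slot L j, p) = None ->
  (p < 2 -> 0 < j) /\ exists j' : 'I_(m i).-1.+1,
    j' = (if p < 2 then j.-1 else j.+1) :> nat /\
    fill_edge (fill_slot L j, p) = (fill_slot L j', rev_ord p).
Proof.
move=> d0; rewrite /fill_edge d0 /inner_edge /=.
move: d0; rewrite /detach /=; case: ifP => // /negbT jE _; split.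
  by move=> p2; rewrite p2 -(inj_eq val_inj) /= in jE; rewrite lt0n.
exists (inord (if p < 2 then j.-1 else j.+1)); split=> //; rewrite inordK //.
have jm := ltn_ord j; case: ifP jE => p2; rewrite -(inj_eq val_inj) /=; lia.
Qed.

(** The pieces of strand caught between the lowest positive vertex of the slot and its vertex number
    [j]. *)
Definition twist_color s i (j : nat) (x : fill_vertex L m * 'I_4) : bool :=
  match x.1 with
  | inl w => false
  | inr (existT i' j') => [&& i' == i, cut_below s i' (level j' x.2) & level j' x.2 <= j]
  end.

(** Between two positive vertices of a twist the strands are trapped: [twist_color] separates the
    lower ends of the upper vertex from its upper ends. *)
Lemma circles_fill_flip s i (j j' : 'I_(m i).-1.+1) : j' < j -> s (fill_slot L j') ->
  let v := fill_slot L j in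
  circles (fill L m) (update s v true) = (circles (fill L m) (update s v false)).+1.
Proof.
move=> j'j sj' v.
have cj : cut_below s i j by apply/existsP; exists j'; rewrite j'j.
apply: (@circles_flip_up _ _ _ _ _ (twist_color s i j)) => [x|x xv|p q]; last first.
- by rewrite /twist_color /= /level eqxx /=; case: (p < 2); case: (q < 2);
    rewrite ?cj ?leqnn ?ltnn ?andbF.
- case: x xv => [[w|[i' k]] p] //= kv; rewrite /twist_color /state_arc /=.
  have [ii|] //= := eqVneq i' i; subst i'.
  have kj : (k : nat) != j by apply: contraNneq kv => /val_inj->.
  rewrite -/(fill_slot L k); case sk: (s _).
    suff -> : level k (smoothing_arc true p) = level k p by [].
    by rewrite /level; case: p => [[|[|[|[|]]]]].
  have cE : cut_below s i k.+1 = cut_below s i k by rewrite cut_belowS sk orbF.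
  have lE (q : 'I_4) : cut_below s i (level k q) && (level k q <= j) =
      cut_below s i k && (k <= j).
    by rewrite /level; case: ifP => _; rewrite ?cE // ltn_neqAle kj.
  by rewrite !lE.
rewrite /= ; case dx: (detach x) => [y|].
  rewrite /fill_edge dx -(detachK dx).
  have t0 z : twist_color s i j (attach m z) = false.
    case: z => [[w|i'] p] //; rewrite /twist_color /attach /level /=.
    have [ii|] //= := eqVneq i' i; subst i'.
    case: (p < 2) => /=; first by rewrite cut_below0.
    by apply/negbTE; rewrite negb_and -ltnNge ltn_ord orbT.
  by rewrite !t0.
case: x dx => [[w|[i' k]] p] // dx.
have [k0 [k' [k'E ->]]] := inner_edgeE dx.
by rewrite /twist_color /= k'E level_inner.
Qed.

(** Slides an end along its column to an end of the slot, upwards if a positive vertex lies below it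
    and downwards otherwise; [rev_ord] exchanges bottom and top in a column. *)
Definition retract s (x : fill_vertex L m * 'I_4) : (rest L + 'I_r) * 'I_4 :=
  match x.1 with
  | inl w => (inl w, x.2)
  | inr (existT i j) =>
      (inr i, if cut_below s i (level j x.2) == (x.2 < 2) then rev_ord x.2 else x.2)
  end.

Section Uncut.
Variable s : fill_vertex L m -> bool.
Hypothesis s_inj : forall i (j j' : 'I_(m i).-1.+1),
  s (fill_slot L j) -> s (fill_slot L j') -> j = j'.

Let e := state_rel (fill L m) s.
Let e' := state_rel (outline L) (slot_state s).

Let edge_e x : connect e x (fill_edge x).
Proof. by apply: connect1; rewrite /e /state_rel /= eqxx. Qed.

Let arc_e x : connect e x (state_arc s x).
Proof. by apply: connect1; rewrite /e /state_rel /= eqxx orbT. Qed.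

Let arc_e' y : connect e' y (state_arc (slot_state s) y).
Proof. by apply: connect1; rewrite /e' /state_rel /= eqxx orbT. Qed.

Let sym_e : connect_sym e. Proof. exact: state_rel_sym. Qed.
Let sym_e' : connect_sym e'. Proof. exact: state_rel_sym. Qed.

Let uncut_arc i (j : 'I_(m i).-1.+1) p : s (fill_slot L j) = false ->
  state_arc s (fill_slot L j, p) = (fill_slot L j, rev_ord p).
Proof.
move=> sj; rewrite /state_arc /= -/(fill_slot L j) sj; congr pair.
by apply: val_inj; case: p => [[|[|[|[|]]]]].
Qed.

Let rev_lt2 (p : 'I_4) : (rev_ord p < 2) = ~~ (p < 2).
Proof. by case: p => [[|[|[|[|]]]]]. Qed.

Let retract_down i (j : 'I_(m i).-1.+1) (p : 'I_4) :
  cut_below s i (level j p) = false ->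
  connect e (attach m (inr i, if p < 2 then p else rev_ord p)) (fill_slot L j, p).
Proof.
case: j => j lt_j; elim: j lt_j p => [|j IHj] lt_j p.
  have b0 (q : 'I_4) : q < 2 -> attach m (inr i, q) = (fill_slot L (Ordinal lt_j), q).
    move=> q2; rewrite /attach /= q2; congr (fill_slot _ _, _).
    by apply: val_inj.
  rewrite /level; case: ifP => p2; first by rewrite b0 // connect0.
  rewrite (cut_belowS s (Ordinal lt_j)) => /norP[_ /negbTE sj].
  rewrite b0 ?rev_lt2 ?p2 //.
  by have := arc_e (fill_slot L (Ordinal lt_j), rev_ord p); rewrite uncut_arc // rev_ordK.
have low (q : 'I_4) : q < 2 -> cut_below s i j.+1 = false ->
    connect e (attach m (inr i, q)) (fill_slot L (Ordinal lt_j), q).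
  move=> q2 cj; have := IHj (ltnW lt_j) (rev_ord q).
  rewrite /level rev_lt2 q2 /= rev_ordK => /(_ cj) /connect_trans; apply.
  rewrite sym_e; have := edge_e (fill_slot L (Ordinal lt_j), q).
  rewrite /fill_edge /detach /= q2 -(inj_eq val_inj) /=; congr connect.
  by rewrite /inner_edge /= q2; congr (fill_slot _ _, _); apply: val_inj; rewrite /= inordK // ltnW.
rewrite /level; case: ifP => p2; first exact: low.
rewrite (cut_belowS s (Ordinal lt_j)) => /norP[/negbTE cj /negbTE sj].
apply: connect_trans (low (rev_ord p) _ cj) _; first by rewrite rev_lt2 p2.
by have := arc_e (fill_slot L (Ordinal lt_j), rev_ord p); rewrite uncut_arc // rev_ordK.
Qed.

Let retract_up i (j : 'I_(m i).-1.+1) (p : 'I_4) :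
  cut_below s i (level j p) ->
  connect e (attach m (inr i, if p < 2 then rev_ord p else p)) (fill_slot L j, p).
Proof.
have [n] := ubnP ((m i).-1 - j); elim: n j p => // n IHn j p jn.
have bot (q : 'I_4) : q < 2 -> cut_below s i j -> s (fill_slot L j) = false.
  move=> q2 /existsP[j' /andP[j'j sj']]; apply/negbTE/negP => /(s_inj sj') jj.
  by rewrite jj ltnn in j'j.
have top (q : 'I_4) : (q < 2) = false -> cut_below s i j.+1 ->
    connect e (attach m (inr i, q)) (fill_slot L j, q).
  move=> q2 cj; have [jmax|jmax] := eqVneq (j : nat) (m i).-1.
    rewrite /attach /= q2; apply: eq_connect0; congr (fill_slot _ _, _).
    exact: val_inj.
  have lt_j : j.+1 < (m i).-1.+1 by rewrite ltnS ltn_neqAle jmax -ltnS ltn_ord.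
  have := IHn (Ordinal lt_j) (rev_ord q).
  rewrite /level rev_lt2 q2 /= rev_ordK => /(_ _ cj) H.
  apply: connect_trans (H _) _; first by rewrite /=; lia.
  rewrite sym_e; have := edge_e (fill_slot L j, q).
  rewrite /fill_edge /detach /= q2 -(inj_eq val_inj) /= (negbTE jmax); congr connect.
  by rewrite /inner_edge /= q2; congr (fill_slot _ _, _); apply: val_inj; rewrite /= inordK.
rewrite /level; case: ifP => p2; last exact: top.
move=> cj; have sj := bot p p2 cj.
apply: connect_trans (top (rev_ord p) _ _) _; first by rewrite rev_lt2 p2.
  by rewrite cut_belowS cj.
by have := arc_e (fill_slot L j, rev_ord p); rewrite uncut_arc // rev_ordK.
Qed.

Let attach_retract x : connect e (attach m (retract s x)) x.
Proof.
case: x => [[w|[i j]] p]; first exact: connect0.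
rewrite /retract /=; case cE: (cut_below s i _).
  by have := retract_up cE; case: (p < 2).
by have := retract_down cE; case: (p < 2).
Qed.

Let retract_attach y : connect e' (retract s (attach m y)) y.
Proof.
case: y => [[w|i] p]; first exact: connect0.
rewrite /attach /retract /level /=; case p2: (p < 2) => /=.
  by rewrite cut_below0 connect0.
rewrite cut_below_max eqbF_neg; case sE: (slot_state s (inr i)); first exact: connect0.
rewrite sym_e'; have := arc_e' (inr i, p); rewrite /state_arc sE; congr connect.
by congr pair; apply: val_inj; case: p {p2} => [[|[|[|[|]]]]].
Qed.

(** With at most one positive vertex per slot, vertical strands link every end to the slot end given
    by [retract], so [retract] and [attach] are inverse up to connectivity. *)
Lemma circles_fill_uncut : circles (fill L m) s = circles (outline L) (slot_state s).
Proof.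
apply: (n_comp_equiv (e := e) (e' := e') (g := retract s) (h := attach m)) => //.
- move=> x y /orP[/eqP->|/eqP->] /=.
    case dx: (detach x) => [z|].
      rewrite /fill_edge dx -(detachK dx); apply: connect_trans (retract_attach _) _.
      rewrite sym_e'; apply: connect_trans (retract_attach _) _.
      by rewrite sym_e'; apply: connect1; rewrite /e' /state_rel /= eqxx.
    apply: eq_connect0; case: x dx => [[w|[i j]] p] // dx.
    have [j0 [j' [j'E ->]]] := inner_edgeE dx.
    rewrite /retract /= j'E level_inner // rev_lt2; congr pair.
    by case: (cut_below _ _ _); case: (p < 2); rewrite //= rev_ordK.
  case: x => [[w|[i j]] p]; first exact: arc_e'.
  have jS := cut_belowS s j; case sj: (s (fill_slot L j)); last first.
    rewrite uncut_arc // /retract /=; apply: eq_connect0; congr pair.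
    rewrite /level rev_lt2; case: (p < 2) => /=; rewrite jS sj orbF;
      by case: (cut_below _ _ _); rewrite //= rev_ordK.
  rewrite /retract /state_arc /= -/(fill_slot L j) sj.
  have cj : cut_below s i j = false.
    by apply/existsP => -[j' /andP[j'j /(s_inj sj) jj]]; rewrite jj ltnn in j'j.
  have arc2 : (smoothing_arc true p < 2) = (p < 2).
    by case: p => [[|[|[|[|]]]]].
  have si : slot_state s (inr i) by apply/existsP; exists j.
  have -> q : (if cut_below s i (level j q) == (q < 2) then rev_ord q else q) = q.
    by rewrite /level; case: (q < 2); rewrite ?cj ?jS ?sj ?orbT.
  rewrite [if _ then _ else smoothing_arc _ _](_ : _ = smoothing_arc true p).
    by have := arc_e' (inr i, p); rewrite /state_arc si.
  by rewrite /level arc2; case: (p < 2); rewrite ?cj ?jS ?sj ?orbT.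
move=> y z /orP[/eqP->|/eqP->] /=.
  by have := edge_e (attach m y); rewrite /fill_edge attachK.
case: y => [[w|i] p]; first exact: arc_e.
rewrite (_ : state_arc _ _ = (inr i, smoothing_arc (slot_state s (inr i)) p)) //.
case sE: (slot_state s (inr i)); last first.
  rewrite (_ : smoothing_arc false p = rev_ord p); last first.
    by apply: val_inj; case: p => [[|[|[|[|]]]]].
  wlog p2 : p / (p < 2) = false => [W|].
    case p2: (p < 2); last exact: W.
    by have := W (rev_ord p); rewrite rev_ordK sym_e rev_lt2 p2; apply.
  rewrite sym_e; have := attach_retract (attach m (inr i, p)).
  by rewrite {1}/attach /retract /level /= p2 cut_below_max sE.
have /existsP[j sj] := sE.
have cj : cut_below s i j = false.
  by apply/existsP => -[j' /andP[j'j /(s_inj sj) jj]]; rewrite jj ltnn in j'j.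
have lift q : connect e (attach m (inr i, q)) (fill_slot L j, q).
  have := attach_retract (fill_slot L j, q); rewrite /retract /level /=.
  by case q2: (q < 2); rewrite ?cut_belowS ?cj ?sj ?orbT.
apply: connect_trans (lift p) _; rewrite sym_e; apply: connect_trans (lift _) _.
by rewrite sym_e; have := arc_e (fill_slot L j, p); rewrite /state_arc /= -/(fill_slot L j) sj.
Qed.

End Uncut.
End FillCircles.

(** * Circles of an arbitrary state of the filled diagram *)

Section FillStates.
Variables (r : nat) (L : twist_diagram r) (m : 'I_r -> nat).
Implicit Types (s : fill_vertex L m -> bool) (t : rest L + 'I_r -> bool) (i : 'I_r).

(** Each positive vertex of a twist beyond the first adds just one circle: flipping back the upper
    of two positive vertices removes a circle and keeps [slot_state]. The induction ends with at
    most one per slot. *)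
Lemma circles_fill s :
  circles (fill L m) s + \sum_i slot_state s (inr i) =
  circles (outline L) (slot_state s) + \sum_(u : {i : 'I_r & 'I_(m i).-1.+1}) s (inr u).
Proof.
have [n] := ubnP (\sum_(u : {i : 'I_r & 'I_(m i).-1.+1}) s (inr u)).
elim: n s => // n IHn s sn.
pose tag_j i (j : 'I_(m i).-1.+1) := Tagged (fun i => 'I_(m i).-1.+1) j.
pose twice (u : {i : 'I_r & 'I_(m i).-1.+1}) :=
  s (inr u) && [exists j' : 'I_(m (tag u)).-1.+1, (j' < tagged u) && s (fill_slot L j')].
case: (pickP twice) => [[i j] /andP[/= sj /existsP[j' /andP[j'j sj']]]|once].
  rewrite -/(fill_slot L j) in sj; set v := fill_slot L j.
  have sE : update s v true =1 s by move=> u; rewrite /update; case: eqP => // ->.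
  have ss' : slot_state (update s v false) =1 slot_state s.
    case=> [w|i'] /=; first by rewrite /update.
    apply/existsP/existsP => -[l sl].
      by exists l; move: sl; rewrite /update; case: ifP.
    have [ll|ll] := eqVneq (fill_slot L l) v; last first.
      by exists l; rewrite /update (negbTE ll).
    case: ll => ii _; subst i'; exists j'; rewrite /update.
    case: eqP => // -[] /eqP; rewrite -tag_eqE /tag_eq /= eqxx /= tagged_asE.
    by move=> /eqP jj; rewrite jj ltnn in j'j.
  rewrite -(eq_circles _ sE) (circles_fill_flip j'j sj').
  have cnt : \sum_(u : {i : 'I_r & 'I_(m i).-1.+1}) s (inr u) =
      (\sum_(u : {i : 'I_r & 'I_(m i).-1.+1}) update s v false (inr u)).+1.
    rewrite (bigD1 (tag_j i j)) //= [in RHS](bigD1 (tag_j i j)) //=.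
    rewrite -/(fill_slot L j) sj /update eqxx add0n add1n; congr _.+1.
    by apply: eq_bigr => u uj; case: eqP => // -[] uj'; rewrite uj' eqxx in uj.
  have IH : _ = _ := IHn (update s v false) _; rewrite cnt in sn *.
  rewrite addSn addnS; congr _.+1.
  rewrite -(eq_circles _ ss') -IH; last by rewrite ltnS in sn.
  by congr (_ + _); apply: eq_bigr => i' _; rewrite ss'.
have s_inj i (j j' : 'I_(m i).-1.+1) : s (fill_slot L j) -> s (fill_slot L j') -> j = j'.
  have nolt (l l' : 'I_(m i).-1.+1) :
      s (fill_slot L l) -> s (fill_slot L l') -> l' < l -> False.
    move=> sl sl' l'l; have := once (tag_j i l); rewrite /twice /= -/(fill_slot L l) sl /=.
    by move/existsP; apply; exists l'; rewrite l'l.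
  move=> sj sj'; apply: val_inj; case: (ltngtP j j') => // jj.
    by case: (nolt _ _ sj' sj jj).
  by case: (nolt _ _ sj sj' jj).
rewrite circles_fill_uncut //; congr (_ + _).
have -> : \sum_(u : {i : 'I_r & 'I_(m i).-1.+1}) s (inr u) =
    \sum_i \sum_(j : 'I_(m i).-1.+1) s (fill_slot L j).
  by rewrite sig_big_dep /=; apply: eq_bigr => -[].
apply: eq_bigr => i _ /=; case: existsP => [[j sj]|sN].
  rewrite (bigD1 j) //= sj big1 // => j' j'j.
  by case: (boolP (s _)) => // sj'; rewrite (s_inj _ _ _ sj sj') eqxx in j'j.
by rewrite big1 // => j _; case: (boolP (s _)) => // sj; case: sN; exists j.
Qed.

(** A section of [slot_state] that puts the value of a slot on its bottom vertex; a flip of a slot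
    thus becomes a flip of a single vertex. *)
Definition lift_state t : fill_vertex L m -> bool :=
  fun v => match v with
  | inl w => t (inl w)
  | inr u => (tagged u == ord0) && t (inr (tag u))
  end.

Lemma circles_lift t : circles (fill L m) (lift_state t) = circles (outline L) t.
Proof.
rewrite circles_fill_uncut => [|i j j' /andP[/= /eqP-> _] /andP[/= /eqP-> _] //].
apply: eq_circles => -[w|i] //=.
by apply/existsP/idP => [[j /andP[]]|ti] //; exists ord0; rewrite eqxx.
Qed.

Definition lift_vertex (u : rest L + 'I_r) : fill_vertex L m :=
  match u with
  | inl w => inl w
  | inr i => @fill_slot _ L m i ord0
  end.

Lemma lift_update t u b :
  lift_state (update t u b) =1 update (lift_state t) (lift_vertex u) b.
Proof.
move=> v; rewrite /update; case: v u => [w|[i j]] [w'|i'] //=.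
have [ii|ii] := eqVneq i i'.
  subst i'; rewrite eqxx; have [->|j0] /= := eqVneq j ord0; first by rewrite eqxx.
  case: eqP => // -[] /eqP; rewrite -tag_eqE /tag_eq /= eqxx /= tagged_asE.
  by rewrite (negbTE j0).
have -> : (inr i == inr i' :> rest L + 'I_r) = false.
  by apply: contraNF ii => /eqP[->].
by case: (_ =P fill_slot L ord0) => // -[ii']; rewrite ii' eqxx in ii.
Qed.

End FillStates.

(** * The bracket of a filled diagram *)

Local Open Scope ring_scope.

(* Each factor [c i + d i * [no j is set]] is expanded by a Boolean [q i]. *)
Lemma sum_block_states (R : comNzRingType) (W I : finType) (J : I -> finType)
    (g : W + {i : I & J i} -> bool -> R) (c d : I -> R) :
  \sum_(s : {ffun W + {i : I & J i} -> bool})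
    (\prod_v g v (s v)) *
    \prod_i (c i + d i * \prod_(j : J i) (~~ s (inr (Tagged J j)))%:R) =
  (\prod_w (g (inl w) true + g (inl w) false)) *
  \prod_i (c i * \prod_(j : J i) (g (inr (Tagged J j)) true + g (inr (Tagged J j)) false)
           + d i * \prod_(j : J i) g (inr (Tagged J j)) false).
Proof.
pose h (q : {ffun I -> bool}) (v : W + {i : I & J i}) b :=
  g v b * (if v is inr u then if q (tag u) then 1 else (~~ b)%:R else 1).
transitivity (\sum_(s : {ffun W + {i : I & J i} -> bool}) \sum_(q : {ffun I -> bool})
    (\prod_i (if q i then c i else d i)) * \prod_v h q v (s v)).
  apply: eq_bigr => s _.
  rewrite (eq_bigr (fun i => \sum_(b : bool)
      (if b then c i else d i * \prod_(j : J i) (~~ s (inr (Tagged J j)))%:R))) => [|i _].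
    rewrite bigA_distr_bigA /= big_distrr /=; apply: eq_bigr => q _.
    rewrite /h big_split /= mulrCA; congr (_ * _).
    rewrite (eq_bigr (fun i => (if q i then c i else d i) *
      \prod_(j : J i) (if q i then 1 else (~~ s (inr (Tagged J j)))%:R))) => [|i _].
      rewrite big_split; congr (_ * _); rewrite [RHS]big_sumType /= [X in _ = X * _]big1 //.
      by rewrite mul1r sig_big_dep /=; apply: eq_bigr => -[i j].
    by case: (q i); rewrite // big1 ?mulr1.
  by rewrite big_bool.
rewrite exchange_big /=.
under eq_bigr => q _.
  rewrite -big_distrr -(bigA_distr_bigA (fun v b => h q v b)) /=.
  rewrite big_sumType /=.
  over.
rewrite (eq_bigr (fun i => \sum_(b : bool)
    (if b then c i * \prod_(j : J i) (g (inr (Tagged J j)) true + g (inr (Tagged J j)) false)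
     else d i * \prod_(j : J i) g (inr (Tagged J j)) false))) => [|i _]; last first.
  by rewrite big_bool.
rewrite bigA_distr_bigA /= big_distrr /=; apply: eq_bigr => q _.
rewrite mulrCA; congr (_ * _).
  by apply: eq_bigr => w _; rewrite big_bool /h !mulr1.
have -> : \prod_u \sum_b h q (inr u) b =
    \prod_i \prod_(j : J i) \sum_b h q (inr (Tagged J j)) b.
  by rewrite sig_big_dep /=; apply: eq_bigr => -[i j].
rewrite -big_split /=; apply: eq_bigr => i _.
case qi: (q i).
  congr (_ * _); apply: eq_bigr => j _.
  by rewrite big_bool /h /= qi !mulr1.
congr (_ * _); apply: eq_bigr => j _.
by rewrite big_bool /h /= qi mulr0 mulr1 add0r.
Qed.

Local Notation delta := (- (A ^+ 2 + A ^- 2)).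

Lemma A_neq0 : A != 0.
Proof. by rewrite tofrac_eq0 polyX_eq0. Qed.

Lemma AX n : A ^+ n = FracField.tofrac 'X^n.
Proof. by rewrite rmorphXn. Qed.

Lemma delta_A : A ^+ 2 * delta = - (1 + A ^+ 4).
Proof.
by rewrite mulrN mulrDr mulfV ?expf_neq0 ?A_neq0 // -exprD addrC.
Qed.

(** The factor contributed by a curl. *)
Lemma kink : A * delta + A^-1 = - A ^+ 3.
Proof.
have -> : A * delta + A^-1 = A^-1 * (A ^+ 2 * delta + 1).
  by rewrite mulrDr mulr1 expr2 -mulrA mulKf ?A_neq0.
by rewrite delta_A opprD addrAC addNr add0r mulrN exprS mulKf ?A_neq0.
Qed.

Lemma delta_neq0 : delta != 0.
Proof.
apply: contraTneq isT => d0; have := delta_A; rewrite d0 mulr0 => /esym/eqP.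
rewrite oppr_eq0 AX -(rmorph1 (@FracField.tofrac _)) -rmorphD tofrac_eq0.
move/eqP/(congr1 (fun p : {poly int} => p`_0)).
by rewrite coefD coef1 coefXn coef0.
Qed.

(** A smoothed vertex gives weight 0 to the other smoothing, so the bracket becomes a sum over all
    states. *)
Definition weight (k : option bool) (b : bool) : laurent :=
  if k is Some b' then (b == b')%:R else if b then A else A^-1.

Lemma bracketE (D : diagram) :
  bracket D = \sum_(s : {ffun vertex D -> bool})
    (\prod_v weight (kind v) (s v)) * delta ^+ circles D s.
Proof.
rewrite /bracket big_mkcond /=; apply: eq_bigr => s _.
case: ifPn => [/forallP sP|/forallPn[v]].
  congr (_ * _); rewrite big_mkcond; apply: eq_bigr => v _.
  by have := sP v; rewrite /weight; case: (kind v) => [b|] //= /eqP[->]; rewrite eqxx.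
rewrite negb_or => /andP[v0 v1]; rewrite (bigD1 v) //= /weight.
case: (kind v) v0 v1 => [b|] // _ sb.
by rewrite (_ : (s v == b) = false) ?mul0r //; apply: contraNF sb => /eqP->.
Qed.

(* [sigma^m = A^-m (1 + A^2 (geom m) e)] in the Temperley-Lieb algebra. *)
Definition geom (m : nat) : {poly int} := \sum_(j < m) (- 'X^4) ^+ j.

Lemma geomE m : 'X^4 * geom m + geom m = 1 - (- 'X^4) ^+ m.
Proof.
rewrite /geom; have := subrX1 (- 'X^4 : {poly int}) m; set g := \sum_(j < m) _ => E.
by rewrite -[RHS]opprB E; ring.
Qed.

Definition twist_weight (m : nat) (b : bool) : laurent :=
  A ^- m * (if b then A ^+ 2 * FracField.tofrac (geom m) else 1).

Lemma twist_weight_false m : A ^- m = twist_weight m false.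
Proof. by rewrite /twist_weight mulr1. Qed.

(** As e e = delta e, sigma acts on e by [- A ^+ 3]; hence [(- A ^+ 3) ^+ m] is the coefficient of 1
    in sigma^m plus delta times that of e. *)
Lemma twist_weight_true m :
  (- A ^+ 3) ^+ m - A ^- m = delta * twist_weight m true.
Proof.
rewrite /twist_weight; set G := FracField.tofrac (geom m).
have E : A ^+ 4 * G + G = 1 - (- A ^+ 4) ^+ m.
  by rewrite !AX -rmorphN -rmorphXn -rmorphM -rmorphD geomE rmorphB rmorph1.
have -> : - A ^+ 3 = A^-1 * (- A ^+ 4).
  by rewrite mulrN exprS mulKf ?A_neq0.
have -> : delta * (A ^- m * (A ^+ 2 * G)) = A ^- m * ((A ^+ 2 * delta) * G) by ring.
rewrite delta_A exprMn exprVn -[in LHS](opprK ((- A ^+ 4) ^+ m)).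
have -> : - (- A ^+ 4) ^+ m = A ^+ 4 * G + G - 1 by rewrite E; ring.
ring.
Qed.

Lemma prod_natr_bool (R : comNzRingType) (T : finType) (b : T -> bool) :
  \prod_i (b i)%:R = [forall i, b i]%:R :> R.
Proof.
case: (boolP [forall i, b i]) => [/forallP bT|/forallPn[i /negbTE bi]].
  by rewrite big1 // => i _; rewrite bT.
by rewrite (bigD1 i) //= bi mul0r.
Qed.

Section BracketFill.
Variables (r : nat) (L : twist_diagram r) (m : 'I_r -> nat).

Lemma slot_weight_false i :
  \prod_(j : 'I_(m i).-1.+1) weight (fill_kind (fill_slot L j)) false = A ^- m i.
Proof.
rewrite /weight /=; case: (m i) => [|n] /=; last by rewrite prodr_const card_ord exprVn.
by rewrite big1 // expr0 invr1.
Qed.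

Lemma slot_weight_sum i :
  \prod_(j : 'I_(m i).-1.+1) (weight (fill_kind (fill_slot L j)) true * delta
     + weight (fill_kind (fill_slot L j)) false) = (- A ^+ 3) ^+ m i.
Proof.
rewrite /weight /=; case: (m i) => [|n] /=.
  by rewrite expr0 big1 // => j _; rewrite mul0r add0r.
rewrite prodr_const card_ord kink; reflexivity.
Qed.

(** Each tangle is replaced by its expansion in 1 and e: states are grouped by their [slot_state],
    and [circles_fill] reduces their circles to those of the outline. *)
Lemma bracket_fill : bracket (fill L m) =
  \sum_(t : {ffun rest L + 'I_r -> bool})
    (\prod_w weight (rest_kind w) (t (inl w))) *
    (\prod_i twist_weight (m i) (t (inr i))) * delta ^+ circles (outline L) t.
Proof.
rewrite bracketE.
rewrite (partition_big (fun s : {ffun fill_vertex L m -> bool} =>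
  [ffun u => slot_state s u]) xpredT) //=.
apply: eq_bigr => t _.
(* Multiplying by this power of [delta] produces the left side of [circles_fill], which is stated
   without subtraction. *)
have dt : delta ^+ (\sum_i t (inr i)) != 0 by rewrite expf_neq0 ?delta_neq0.
apply: (mulIf dt); rewrite big_distrl /=.
pose g (v : fill_vertex L m) b := match v with
  | inl w => weight (rest_kind w) b * (b == t (inl w))%:R
  | inr u => weight (fill_kind v) b * delta ^+ b
  end.
(* With these coefficients the factor of [i] in [sum_block_states] is the indicator of
   [slot_state s (inr i) = t (inr i)]. *)
pose c i : laurent := (t (inr i))%:R.
pose d i : laurent := if t (inr i) then - 1 else 1.
transitivity (delta ^+ circles (outline L) t * \sum_(s : {ffun fill_vertex L m -> bool})
    (\prod_v g v (s v)) * \prod_i (c i + d i *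
      \prod_(j : 'I_(m i).-1.+1) (~~ s (inr (Tagged (fun i => 'I_(m i).-1.+1) j)))%:R)).
  rewrite big_distrr big_mkcond /=; apply: eq_bigr => s _.
  have -> : \prod_i (c i + d i * \prod_(j : 'I_(m i).-1.+1)
      (~~ s (inr (Tagged (fun i => 'I_(m i).-1.+1) j)))%:R) =
      [forall i, slot_state s (inr i) == t (inr i)]%:R.
    rewrite -prod_natr_bool; apply: eq_bigr => i _.
    rewrite prod_natr_bool -negb_exists -/(slot_state s (inr i)) /c /d.
    by case: (slot_state _ _); case: (t _); rewrite ?mulr0 ?mulr1 ?addr0 ?subrr ?add0r.
  have -> : \prod_v g v (s v) = (\prod_v weight (fill_kind v) (s v)) *
      (delta ^+ (\sum_u s (inr u)) * [forall w, s (inl w) == t (inl w)]%:R).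
    rewrite big_sumType [\prod_v weight _ _]big_sumType /= /g !big_split /=.
    by rewrite prod_natr_bool -expr_sum mulrACA [delta ^+ _ * _]mulrC.
  have -> : ([ffun u => slot_state s u] == t) =
      [forall i, slot_state s (inr i) == t (inr i)] && [forall w, s (inl w) == t (inl w)].
    apply/eqP/andP => [<-|[/forallP si /forallP sw]].
      by split; apply/forallP => u; rewrite ffunE.
    by apply/ffunP => u; rewrite ffunE; apply/eqP; case: u => [w|i]; [apply: sw|apply: si].
  case: (boolP [forall i, _]) => [/forallP si|_]; last by rewrite !mulr0.
  case: (boolP [forall w, _]) => [/forallP sw|_]; last by rewrite !(mulr0, mul0r).
  have -> : circles (outline L) t = circles (outline L) (slot_state s).
    apply: eq_circles => -[w|i]; first exact/esym/eqP/sw.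
    by rewrite (eqP (si i)).
  have -> : (\sum_i t (inr i) = \sum_i slot_state s (inr i))%N.
    by apply: eq_bigr => i _; rewrite (eqP (si i)).
  rewrite andbT !mulr1 -mulrA -exprD [(circles _ s + _)%N](circles_fill s) exprD mulrCA.
  reflexivity.
rewrite sum_block_states mulrC [RHS]mulrAC; congr (_ * _).
rewrite /g expr_sum -[RHS]mulrA -[in RHS]big_split /=; congr (_ * _).
  apply: eq_bigr => w _.
  by case: (t _); rewrite ?mulr0 ?mulr1 ?addr0 ?add0r.
apply: eq_bigr => i _; rewrite expr1.
have -> : \prod_(j : 'I_(m i).-1.+1) (weight (fill_kind (fill_slot L j)) true * delta
     + weight (fill_kind (fill_slot L j)) false * delta ^+ 0) = (- A ^+ 3) ^+ m i.
  by rewrite -slot_weight_sum; apply: eq_bigr => j _; rewrite expr0 mulr1.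
have -> : \prod_(j : 'I_(m i).-1.+1) (weight (fill_kind (fill_slot L j)) false * delta ^+ 0)
    = A ^- m i.
  by rewrite -slot_weight_false; apply: eq_bigr => j _; rewrite expr0 mulr1.
rewrite /c /d; case: (t _).
  by rewrite mul1r mulN1r twist_weight_true expr1 mulrC.
by rewrite mul0r mul1r add0r expr0 mulr1 twist_weight_false.
Qed.

End BracketFill.

(** * State sums *)

Definition eqmodX (d : nat) (p q : {poly int}) : Prop := exists r, p = q + 'X^d * r.

Lemma eqmodX_refl d p : eqmodX d p p.
Proof. by exists 0; rewrite mulr0 addr0. Qed.

Lemma eqmodX_add d p q p' q' :
  eqmodX d p q -> eqmodX d p' q' -> eqmodX d (p + p') (q + q').
Proof. by move=> [r ->] [r' ->]; exists (r + r'); ring. Qed.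

Lemma eqmodX_mul d p q p' q' :
  eqmodX d p q -> eqmodX d p' q' -> eqmodX d (p * p') (q * q').
Proof.
by move=> [r ->] [r' ->]; exists (r * q' + q * r' + 'X^d * r * r'); ring.
Qed.

Lemma eqmodX_mulX d e p q : eqmodX d p q -> eqmodX (e + d) ('X^e * p) ('X^e * q).
Proof. by move=> [r ->]; exists r; rewrite exprD; ring. Qed.

Lemma eqmodX_weaken d e p q : (e <= d)%N -> eqmodX d p q -> eqmodX e p q.
Proof.
by move=> ed [r ->]; exists ('X^(d - e) * r); rewrite mulrA -exprD subnKC.
Qed.

Lemma eqmodX_coef d p q i : eqmodX d p q -> (i < d)%N -> p`_i = q`_i.
Proof. by move=> [r ->] id; rewrite coefD coefXnM id addr0. Qed.

Lemma geom_pred m : (0 < m)%N -> eqmodX (4 * (m - 1)) (geom m) (geom (m - 1)).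
Proof.
case: m => // m _; rewrite subn1 /= /geom big_ord_recr /= -mulN1r exprMn -exprM.
by exists ((- 1) ^+ m); rewrite [_ * (-1) ^+ m]mulrC.
Qed.

Lemma tofrac_geom m :
  (A ^+ 2 * delta) * FracField.tofrac (geom m) + 1 = (- A ^+ 4) ^+ m.
Proof.
have E : A ^+ 4 * FracField.tofrac (geom m) + FracField.tofrac (geom m) =
    1 - (- A ^+ 4) ^+ m.
  by rewrite !AX -rmorphN -rmorphXn -rmorphM -rmorphD geomE rmorphB rmorph1.
rewrite delta_A mulNr mulrDl mul1r addrC [X in _ - X]addrC E opprB addrCA subrr.
exact: addr0.
Qed.

Section StateSum.
Variables (U : finType) (N : {set U} -> nat) (act : {set U}).
Hypothesis N_le : forall (S : {set U}) u, u \in act -> (N (u |: S) <= (N S).+1)%N.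

(** The nugatory vertices: flipping one adds a circle whatever other active vertices are flipped. *)
Definition bad : {set U} := [set u in act |
  [forall S : {set U}, (S \subset act) ==> (u \notin S) ==> (N (u |: S) == (N S).+1)]].

Hypothesis N_good : forall u, u \in act -> u \notin bad -> (N [set u]).+1 = N set0.

Definition term (n : U -> nat) (S : {set U}) : laurent :=
  delta ^+ N S * \prod_(u in S) (A ^+ 2 * FracField.tofrac (geom (n u))).

(** Flipping [u] multiplies the term by [A ^+ 2 * delta] times a geometric sum, which telescopes to
    a monomial minus 1. *)
Lemma term_bad (n : U -> nat) u (S : {set U}) :
    u \in bad -> S \subset act -> u \notin S ->
  term n (u |: S) + term n S = (- A ^+ 4) ^+ n u * term n S.
Proof.
rewrite inE => /andP[_ /forallP/(_ S)/implyP H] /[dup] /H /implyP {}H _ /[dup] /H /eqP NS uS.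
rewrite /term NS big_setU1 //= exprS -tofrac_geom mulrDl mul1r; congr (_ + _).
set G := FracField.tofrac _; set P := \prod_(_ in _) _.
by rewrite [A ^+ 2 * delta]mulrC -[_ * A ^+ 2 * G]mulrA mulrACA.
Qed.

Lemma sum_bad (n : U -> nat) (P : pred {set U}) u : u \in bad ->
    (forall S : {set U}, P S -> S \subset act) ->
    (forall S : {set U}, u \notin S -> P (u |: S) = P S) ->
  \sum_(S | P S) term n S =
  (- A ^+ 4) ^+ n u * \sum_(S : {set U} | P S && (u \notin S)) term n S.
Proof.
move=> ub Pact PU; rewrite (bigID (fun S : {set U} => u \in S)) /=.
rewrite (reindex_onto (fun S => u |: S) (fun S => S :\ u)) /=; last first.
  by move=> S /andP[_ uS]; apply: setD1K.
rewrite (eq_bigl (fun S : {set U} => P S && (u \notin S))) => [|S]; last first.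
  rewrite setU11 andbT; have [uS|uS] := boolP (u \in S).
    rewrite andbF; apply/negP => /andP[_ /eqP E].
    by have := setD11 u (u |: S); rewrite E uS.
  by rewrite PU // andbT setU1K // eqxx andbT.
rewrite -big_split big_distrr /=; apply: eq_bigr => S /andP[PS uS].
by rewrite term_bad // Pact.
Qed.

Lemma sum_terms (n : U -> nat) : (forall u, u \notin act -> n u = 0%N) ->
  \sum_S term n S = (- A ^+ 4) ^+ (\sum_(u in bad) n u) *
    \sum_(S : {set U} | (S \subset act) && [disjoint S & bad]) term n S.
Proof.
move=> n0; rewrite -[in X in _ ^+ X]big_enum /=.
have : {subset enum bad <= bad} by move=> u; rewrite mem_enum.
have uniqB := enum_uniq bad.
have -> : \sum_(S : {set U} | (S \subset act) && [disjoint S & bad]) term n S =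
    \sum_(S : {set U} | (S \subset act) && [disjoint S & enum bad]) term n S.
  apply: eq_bigl => S; congr (_ && _); rewrite disjoint_sym [RHS]disjoint_sym.
  by apply: eq_disjoint => u; rewrite mem_enum.
(* Nugatory vertices are summed out one at a time: each leaves a monomial and restricts the sum to
   sets avoiding it. Sets with an inactive element vanish because [geom 0] is 0. *)
elim: (enum bad) uniqB => [_ _|u B IHB /= /andP[uB /IHB {}IHB] sub].
  rewrite big_nil expr0 mul1r [LHS](bigID (fun S : {set U} => S \subset act)) /=.
  rewrite [X in _ + X]big1 ?addr0 => [|S /subsetPn[u uS ua]].
    by apply: eq_bigl => S; rewrite disjoint_sym disjoint0 andbT.
  rewrite /term (bigD1 u) //= n0 // /geom big_ord0 tofrac0 mulr0 mul0r.
  exact: mulr0.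
rewrite IHB => [|w wB]; last by rewrite sub // inE wB orbT.
rewrite big_cons [in RHS]addnC exprD -mulrA; congr (_ * _).
have ub : u \in bad by rewrite sub // mem_head.
rewrite (@sum_bad _ _ u) // => [|S /andP[] //|S uS].
  congr (_ * _); apply: eq_bigl => S; rewrite -andbA; congr (_ && _).
  by rewrite [RHS]disjoint_sym disjoint_cons disjoint_sym andbC.
have ua : u \in act by move: ub; rewrite inE => /andP[].
rewrite subUset sub1set ua; congr (_ && _).
rewrite ![[disjoint _ & B]]disjoint_sym !disjoint_has; congr (~~ _).
apply: eq_in_has => w wB; rewrite !inE; case: eqP => // wu.
by rewrite -wu wB in uB.
Qed.

Lemma N_addset (S T : {set U}) : T \subset act -> (N (T :|: S) <= N S + #|T|)%N.
Proof.
have [n] := ubnP #|T|; elim: n T => // n IHn T Tn Ta.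
have [->|[u uT]] := set_0Vmem T; first by rewrite set0U leq_addr.
have Tu : #|T| = #|T :\ u|.+1 by rewrite (cardsD1 u) uT.
have ua : u \in act by apply: (subsetP Ta).
rewrite -(setD1K uT) -setUA (leq_trans (N_le _ ua)) // (setD1K uT) Tu addnS ltnS.
by apply: IHn; [rewrite -ltnS -Tu|apply: subset_trans Ta; apply: subD1set].
Qed.

(** One good flip loses a circle, and each of the remaining ones gains at most one. *)
Lemma N_good_set (S : {set U}) : S \subset act -> [disjoint S & bad] -> S != set0 ->
  (N S + 2 <= N set0 + #|S|)%N.
Proof.
move=> Sa Sb /set0Pn[u uS].
have ua : u \in act by apply: (subsetP Sa).
have ub : u \notin bad.
  by move: Sb; rewrite disjoint_subset => /subsetP/(_ u uS).
rewrite -(N_good ua ub).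
have Su : #|S| = #|S :\ u|.+1 by rewrite (cardsD1 u) uS.
have := @N_addset [set u] (S :\ u); rewrite setUC setD1K //.
by move=> /(_ (subset_trans (subD1set S u) Sa)); rewrite Su; lia.
Qed.

(** [term] times [A ^+ (2 * N set0)], made polynomial by [A ^+ 2 * delta = - (1 + A ^+ 4)]. The
    truncated subtraction is exact when [N S <= N set0 + #|S|]. *)
Definition normal_term (n : U -> nat) (S : {set U}) : {poly int} :=
  'X^(2 * (N set0 + #|S| - N S)) *
  ((- (1 + 'X^4)) ^+ N S * \prod_(u in S) geom (n u)).

Definition normal_sum (n : U -> nat) : {poly int} :=
  \sum_(S : {set U} | (S \subset act) && [disjoint S & bad]) normal_term n S.

Lemma tofrac_normal_term (n : U -> nat) (S : {set U}) : (N S <= N set0 + #|S|)%N ->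
  FracField.tofrac (normal_term n S) = A ^+ (2 * N set0) * term n S.
Proof.
move=> NS; rewrite /normal_term /term !rmorphM !rmorphXn rmorphN rmorphD rmorph1 !rmorphXn /=.
rewrite -/A rmorph_prod -delta_A exprMn big_split /= prodr_const.
set P := \prod_(_ in _) _; rewrite !mulrA; congr (_ * _).
rewrite -!exprM -exprD -mulnDr subnK // mulnDr exprD -!mulrA; congr (_ * _).
exact: mulrC.
Qed.

Lemma sum_terms_normal (n : U -> nat) : (forall u, u \notin act -> n u = 0%N) ->
  \sum_S term n S = A ^- (2 * N set0) *
    ((- A ^+ 4) ^+ (\sum_(u in bad) n u) * FracField.tofrac (normal_sum n)).
Proof.
move=> n0; rewrite sum_terms // mulrCA; congr (_ * _).
have A0 : A ^+ (2 * N set0) != 0 by rewrite expf_neq0 ?A_neq0.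
apply: (mulfI A0); rewrite mulVKf // /normal_sum rmorph_sum big_distrr /=.
apply: eq_bigr => S /andP[Sa Sb]; rewrite tofrac_normal_term //.
have [->|S0] := eqVneq S set0; first by rewrite leq_addr.
by have := N_good_set Sa Sb S0; lia.
Qed.

(** For nonempty [S] the power of X supplies at least 4 and the geometric sums agree modulo X^d; for
    empty [S] both sides are equal. *)
Lemma normal_term_mod d (n n' : U -> nat) (S : {set U}) :
    S \subset act -> [disjoint S & bad] ->
    (forall u, eqmodX d (geom (n u)) (geom (n' u))) ->
  eqmodX (4 + d) (normal_term n S) (normal_term n' S).
Proof.
move=> Sa Sb nn'; rewrite /normal_term.
have [->|S0] := eqVneq S set0; first by rewrite !big_set0; apply: eqmodX_refl.
have le4 : (4 + d <= 2 * (N set0 + #|S| - N S) + d)%N.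
  by have := N_good_set Sa Sb S0; lia.
apply: (eqmodX_weaken le4); apply: eqmodX_mulX; apply: eqmodX_mul; first exact: eqmodX_refl.
by apply: (big_ind2 (eqmodX d)) => [|*|*]; [apply: eqmodX_refl|apply: eqmodX_mul|].
Qed.

Lemma normal_sum_mod d (n n' : U -> nat) : (forall u, eqmodX d (geom (n u)) (geom (n' u))) ->
  eqmodX (4 + d) (normal_sum n) (normal_sum n').
Proof.
move=> nn'; apply: (big_ind2 (eqmodX (4 + d))) => [|*|S /andP[Sa Sb]].
- exact: eqmodX_refl.
- exact: eqmodX_add.
exact: normal_term_mod.
Qed.

(** Only the empty set has a constant term, and it is a sign. *)
Lemma normal_sum_coef0 n : (normal_sum n)`_0 != 0.
Proof.
rewrite /normal_sum (bigD1 set0) /=; last first.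
  by rewrite sub0set disjoints_subset sub0set.
rewrite coefD coef_sum big1 ?addr0 => [|S /andP[/andP[Sa Sb] S0]].
  rewrite /normal_term big_set0 cards0 addn0 subnn expr0 mul1r mulr1.
  by rewrite -horner_coef0 !hornerE /= signr_eq0.
have := N_good_set Sa Sb S0; rewrite /normal_term coefXnM.
by case: ifP => //; lia.
Qed.

End StateSum.

Lemma doteq_monomials (n a1 a2 b1 b2 : nat) (p1 p2 : {poly int}) :
    p1`_0 != 0 -> p2`_0 != 0 -> (forall i, (i < n)%N -> p1`_i = p2`_i) ->
  doteq n (A ^- a1 * ((- A ^+ 4) ^+ b1 * FracField.tofrac p1))
          (A ^- a2 * ((- A ^+ 4) ^+ b2 * FracField.tofrac p2)).
Proof.
move=> p10 p20 p12.
have monomialE (a b : nat) (p : {poly int}) :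
    A ^- a * ((- A ^+ 4) ^+ b * FracField.tofrac p) =
    A ^ ((4 * b)%N%:Z - a%:Z) * FracField.tofrac ((- 1) ^+ b * p).
  rewrite expfzDr ?A_neq0 // -exprnN /= -exprnP exprM.
  rewrite rmorphM rmorphXn rmorphN rmorph1 /= [(- A ^+ 4) ^+ b]exprNn.
  rewrite [(- 1) ^+ b * A ^+ 4 ^+ b]mulrC !mulrA; congr (_ * _ * _).
  exact: mulrC.
(* The monomials go into the lowest degrees and their signs into the polynomials; the product of the
   two signs is the overall one. *)
exists ((4 * b1)%N%:Z - a1%:Z), ((4 * b2)%N%:Z - a2%:Z).
exists ((- 1) ^+ b1 * p1), ((- 1) ^+ b2 * p2), (odd (b1 + b2)).
have signE b p i : ((- 1) ^+ b * p : {poly int})`_i = (- 1) ^+ b * p`_i.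
  rewrite -[in LHS]signr_odd -[in RHS]signr_odd.
  by case: (odd b); rewrite /= ?expr1 ?expr0 ?mulN1r ?mul1r ?coefN.
split; rewrite ?signE ?mulf_neq0 ?signr_eq0 //.
move=> i lt_i; rewrite !signE p12 // signr_odd exprD -mulrA; congr (_ * _).
by rewrite mulrA -expr2 sqrr_sign mul1r.
Qed.

(** * Conclusion *)

Section OutlineStates.
Variables (r : nat) (L : twist_diagram r).
Let U : finType := (rest L + 'I_r)%type.

Definition outline_kind (u : U) : option bool :=
  if u is inl w then rest_kind w else None.

(** Flips are measured against the state in which all crossings and slots are negative. *)
Definition flipped (S : {set U}) (u : U) : bool :=
  odflt false (outline_kind u) (+) (u \in S).

Definition outline_circles (S : {set U}) : nat := circles (outline L) (flipped S).

Definition active : {set U} := [set u | outline_kind u == None].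

Lemma flipped_set1U (S : {set U}) u : u \in active ->
  flipped (u |: S) =1 update (flipped S) u true.
Proof.
rewrite inE => /eqP ku v; rewrite /flipped /update !inE.
by case: eqP => [->|] //=; rewrite ku.
Qed.

Lemma flipped_id (S : {set U}) u : u \in active -> u \notin S ->
  flipped S =1 update (flipped S) u false.
Proof.
rewrite inE => /eqP ku uS v; rewrite /flipped /update.
by case: eqP => [->|] //=; rewrite ku (negbTE uS).
Qed.

Lemma outline_circles_le (S : {set U}) u : u \in active ->
  (outline_circles (u |: S) <= (outline_circles S).+1)%N.
Proof.
move=> ua; have [uS|uS] := boolP (u \in S).
  by rewrite (setUidPr _) ?sub1set // leqnSn.
rewrite /outline_circles (eq_circles _ (flipped_set1U S ua)).
rewrite [in X in (_ <= X)%N](eq_circles _ (flipped_id ua uS)).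
exact: circles_flip_le.
Qed.

(** A crossing outside the slots counts as a twist with one crossing and a smoothed vertex as one
    with none; [geom 0 = 0] then kills the flips of smoothed vertices. *)
Definition multiplicity (m : 'I_r -> nat) (u : U) : nat :=
  match u with
  | inl w => rest_kind w == None
  | inr i => m i
  end.

Lemma multiplicity_inactive m u : u \notin active -> multiplicity m u = 0%N.
Proof. by rewrite inE; case: u => [w|i] //= /negbTE->. Qed.

(** With the negative power of [A] of each vertex pulled out, only the multiplicities depend on [m];
    the circle numbers belong to the outline. *)
Lemma bracket_outline m : bracket (fill L m) =
  A ^- (\sum_u multiplicity m u) * \sum_S term outline_circles (multiplicity m) S.
Proof.
rewrite bracket_fill.
pose f (S : {set U}) : {ffun U -> bool} := [ffun u => flipped S u].
pose f' (t : {ffun U -> bool}) : {set U} :=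
  [set u | odflt false (outline_kind u) (+) t u].
have fK : cancel f f'.
  by move=> S; apply/setP => u; rewrite inE ffunE /flipped addKb.
have f'K : cancel f' f.
  by move=> t; apply/ffunP => u; rewrite ffunE /flipped inE addKb.
rewrite (reindex f) /=; last by exists f' => ? _.
rewrite big_distrr /=; apply: eq_bigr => S _.
have -> : circles (outline L) (f S) = outline_circles S.
  by apply: eq_circles => u; rewrite ffunE.
rewrite /term [delta ^+ _ * _]mulrC mulrA; congr (_ * _).
transitivity (\prod_u (A ^- multiplicity m u *
    (if u \in S then A ^+ 2 * FracField.tofrac (geom (multiplicity m u)) else 1))).
  rewrite [RHS]big_sumType /=; congr (_ * _); apply: eq_bigr; last first.
    by move=> i _; rewrite ffunE.
  move=> w _; rewrite ffunE /flipped /weight /=; case: (rest_kind w) => [b|] /=.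
    rewrite expr0 invr1 mul1r /geom big_ord0 tofrac0 mulr0.
    by case: b; case: (_ \in _).
  rewrite expr1 /geom big_ord1 expr0 tofrac1 mulr1.
  case: (_ \in _); last by rewrite mulr1.
  by rewrite expr2 mulKf // A_neq0.
rewrite big_split /= -big_mkcond /= prodfV -expr_sum; reflexivity.
Qed.

End OutlineStates.

(** * Good and nugatory vertices of the outline *)

Section Outline.
Variables (r : nat) (L : twist_diagram r) (k : 'I_r -> nat).
Hypothesis k_gt0 : forall i, (0 < k i)%N.
Hypothesis sphL : spherical (fill L k).
Hypothesis altL : alternating (fill L k).

Let N := @outline_circles r L.
Let act := @active r L.

Lemma fill_kind_slot i (j : 'I_(k i).-1.+1) : fill_kind (fill_slot L j) = None.
Proof. by rewrite /fill_kind /= gtn_eqF. Qed.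

Lemma lift_kind (S : {set rest L + 'I_r}) : S \subset act ->
  forall (v : vertex (fill L k)) b, kind v = Some b -> lift_state (m := k) (flipped S) v = b.
Proof.
move=> Sa [w|[i j]] b /= kv; last by rewrite gtn_eqF in kv.
have /negbTE wS : inl w \notin S.
  by apply/negP => /(subsetP Sa); rewrite inE /= kv.
by rewrite /flipped wS /= kv; case: (b).
Qed.

Lemma lift_base : lift_state (m := k) (flipped set0) =1 @base_state (fill L k).
Proof.
case=> [w|[i j]]; first by rewrite /lift_state /flipped inE addbF.
by rewrite /lift_state /flipped inE /= andbF /base_state /= gtn_eqF.
Qed.

(** A slot is represented by the bottom crossing of its twist in L(k), to which [crossing_dichotomy]
    applies. The conclusion concerns the outline alone and so serves both fillings. *)
Lemma outline_dichotomy u : u \in act ->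
  (forall S : {set rest L + 'I_r}, S \subset act -> u \notin S -> N (u |: S) = (N S).+1) \/
  (N [set u]).+1 = N set0.
Proof.
move=> ua; pose v : vertex (fill L k) := lift_vertex k u.
have kv : kind v = None.
  by move: ua; rewrite inE /v; case: (u) => [w /eqP //|i _]; apply: fill_kind_slot.
have NE (S : {set rest L + 'I_r}) b :
    circles (outline L) (update (flipped S) u b) =
    circles (fill L k) (update (lift_state (m := k) (flipped S)) v b).
  by rewrite -(@circles_lift _ _ k); apply: eq_circles => x; rewrite lift_update.
have [up|down] := crossing_dichotomy sphL altL kv; [left => S Sa uS|right].
  rewrite /N /outline_circles (eq_circles _ (flipped_set1U S ua)) NE up; last exact: lift_kind.
  by rewrite -NE -(eq_circles _ (flipped_id ua uS)).
have u0 : u \notin (set0 : {set rest L + 'I_r}) by rewrite inE.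
rewrite -(setU0 [set u]) /N /outline_circles (eq_circles _ (flipped_set1U set0 ua)).
rewrite [RHS](eq_circles _ (flipped_id ua u0)) !NE.
have lb b : update (lift_state (m := k) (flipped set0)) v b =1
    update (@base_state (fill L k)) v b.
  by move=> x; rewrite /update lift_base.
by rewrite !(eq_circles _ (lb _)).
Qed.

Lemma outline_good u : u \in act -> u \notin bad N act -> (N [set u]).+1 = N set0.
Proof.
move=> ua ub; case: (outline_dichotomy ua) => // up; case/negP: ub.
rewrite inE ua; apply/forallP => S; apply/implyP => Sa; apply/implyP => uS.
by rewrite up.
Qed.

End Outline.

Local Close Scope ring_scope.

Theorem theorem3p6 (r : nat) (L : twist_diagram r.+1) (k : 'I_r.+1 -> nat) :
  (forall i, 0 < k i)%N ->
  spherical (fill L k) ->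
  alternating (fill L k) ->
  (forall i, maximal_negative_twist_region (fill_twist L k i)) ->
  doteq (4 * \big[minn/k ord0]_(i < r.+1) k i)
    (bracket (fill L k)) (bracket (fill L (fun i => (k i - 1)%N))).
Proof.
move=> k_gt0 sphL altL _; set K := \big[minn/k ord0]_(i < r.+1) k i.
have K_le i : (K <= k i)%N.
  rewrite /K; have: i \in index_enum 'I_r.+1 by rewrite mem_index_enum.
  elim: (index_enum _) => //= j s IHs; rewrite inE big_cons geq_min.
  by case/orP => [/eqP->|/IHs->]; rewrite ?leqnn ?orbT.
have K_gt0 : (0 < K)%N.
  by apply: (big_ind (fun n => 0 < n)%N) => // x y x0 y0; rewrite leq_min x0.
pose k' i := (k i - 1)%N.
have geomE u : eqmodX (4 * (K - 1))
    (geom (multiplicity (L := L) k u)) (geom (multiplicity (L := L) k' u)).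
  case: u => [w|i]; first exact: eqmodX_refl.
  apply: eqmodX_weaken (geom_pred (k_gt0 i)).
  by rewrite leq_mul2l leq_sub2r.
have Nle := @outline_circles_le _ L; have Ngood := outline_good k_gt0 sphL altL.
have normE (m : 'I_r.+1 -> nat) := sum_terms_normal Nle Ngood (@multiplicity_inactive _ L m).
(* Both brackets become a power of [A] times a monomial times a [normal_sum] over the same sets of
   good vertices. *)
rewrite !bracket_outline !normE !mulrA -!invfM -!exprD -!mulrA.
apply: doteq_monomials; try exact: normal_sum_coef0.
move=> i lt_i; apply: eqmodX_coef (normal_sum_mod Nle Ngood geomE) _.
(* The 4 gained by every nonempty set of flips gives 4 + 4 (K - 1) = 4 K, as [K] is positive. *)
by rewrite -mulnS subn1 prednK.
Qed.
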